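(* Fix the data $\{\mathbf{u}_l^{(m)}\}$, $\{\mathbf{y}_l^{(m)}\}$, the time step $\Delta t>0$, the inference densities $Q^{(1)},\dots,Q^{(M)}$ (with means $\hat{\boldsymbol\mu}_k^{(m)}$ and covariances $\hat{\boldsymbol\Sigma}_{k,l}^{(m)}$), and coefficients $\gamma_{\mathbf{G}},\gamma_{\mathbf{w}},\gamma_0,\gamma_{\mathbf{v}}\ge 0$, as described in the context. Define $$\mathbf{G}=\sum_{m=1}^{M}\sum_{l=0}^{L-1}\mathbf{u}_l^{(m)}\otimes\big(\mathbf{u}_l^{(m)}\big)^T\otimes\begin{bmatrix}1&(\hat{\boldsymbol\mu}_l^{(m)})^T\\ \hat{\boldsymbol\mu}_l^{(m)}&\hat{\boldsymbol\Sigma}_{l,l}^{(m)}+\hat{\boldsymbol\mu}_l^{(m)}(\hat{\boldsymbol\mu}_l^{(m)})^T\end{bmatrix}+\gamma_{\mathbf{G}}\mathbf{I},$$ $$\mathbf{H}=\sum_{m=1}^{M}\sum_{l=0}^{L-1}\big(\mathbf{u}_l^{(m)}\big)^T\otimes\begin{bmatrix}\dfrac{\hat{\boldsymbol\mu}_{l+1}^{(m)}-\hat{\boldsymbol\mu}_l^{(m)}}{\Delta t}&\ \ \dfrac{\hat{\boldsymbol\Sigma}_{l+1,l}^{(m)}-\hat{\boldsymbol\Sigma}_{l,l}^{(m)}}{\Delta t}+\dfrac{\hat{\boldsymbol\mu}_{l+1}^{(m)}-\hat{\boldsymbol\mu}_l^{(m)}}{\Delta t}(\hat{\boldsymbol\mu}_l^{(m)})^T\end{bmatrix},$$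 where $\otimes$ is the Kronecker product. Assuming $\mathbf{G}$ is positive-definite, define $\tilde{\mathbf{V}}_0,\dots,\tilde{\mathbf{V}}_q\in\mathbb{R}^{(1+n)\times n}$ by $$\begin{bmatrix}\tilde{\mathbf{V}}_0^T&\cdots&\tilde{\mathbf{V}}_q^T\end{bmatrix}=\mathbf{H}\mathbf{G}^{-1},$$ let $\mathbf{A}_l^{(m)},\mathbf{b}_l^{(m)}$ be the matrices and vectors determined by these $\tilde{\mathbf{V}}_k$ and the inputs $\mathbf{u}_l^{(m)}$ (see context), and set $$\begin{aligned}\boldsymbol\Sigma_{\mathbf{w}}=\frac{1}{ML}\sum_{m=1}^M\sum_{l=0}^{L-1}\Big[&\hat{\boldsymbol\Sigma}_{l+1,l+1}^{(m)}-\mathbf{A}_l^{(m)}\hat{\boldsymbol\Sigma}_{l,l+1}^{(m)}-\hat{\boldsymbol\Sigma}_{l+1,l}^{(m)}(\mathbf{A}_l^{(m)})^T+\mathbf{A}_l^{(m)}\hat{\boldsymbol\Sigma}_{l,l}^{(m)}(\mathbf{A}_l^{(m)})^T\\&+\big(\hat{\boldsymbol\mu}_{l+1}^{(m)}-\mathbf{A}_l^{(m)}\hat{\boldsymbol\mu}_l^{(m)}-\mathbf{b}_l^{(m)}\big)\big(\hat{\boldsymbol\mu}_{l+1}^{(m)}-\mathbf{A}_l^{(m)}\hat{\boldsymbol\mu}_l^{(m)}-\mathbf{b}_l^{(m)}\big)^T\Big]+\frac{\gamma_{\mathbf{G}}\Delta t^2}{ML}\sum_{i=0}^{q}\tilde{\mathbf{V}}_i^T\tilde{\mathbf{V}}_i+\frac{\gamma_{\mathbf{w}}}{ML}\mathbf{I},\end{aligned}$$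 $$\boldsymbol\mu_0=\frac1M\sum_{m=1}^M\hat{\boldsymbol\mu}_0^{(m)},\qquad \boldsymbol\Sigma_0=\frac1M\sum_{m=1}^M\Big[\hat{\boldsymbol\Sigma}_{0,0}^{(m)}+\big(\hat{\boldsymbol\mu}_0^{(m)}-\boldsymbol\mu_0\big)\big(\hat{\boldsymbol\mu}_0^{(m)}-\boldsymbol\mu_0\big)^T\Big]+\frac{\gamma_0}{M}\mathbf{I},$$ $$\mathbf{c}_0=\frac{1}{M(L+1)}\sum_{m=1}^M\sum_{l=0}^L\big(\mathbf{y}_l^{(m)}-\tilde{\mathbf{C}}\hat{\boldsymbol\mu}_l^{(m)}\big),$$ $$\boldsymbol\Sigma_{\mathbf{v}}=\frac{1}{M(L+1)}\sum_{m=1}^M\sum_{l=0}^L\Big[\tilde{\mathbf{C}}\hat{\boldsymbol\Sigma}_{l,l}^{(m)}\tilde{\mathbf{C}}^T+\big(\mathbf{y}_l^{(m)}-\mathbf{c}_0-\tilde{\mathbf{C}}\hat{\boldsymbol\mu}_l^{(m)}\big)\big(\mathbf{y}_l^{(m)}-\mathbf{c}_0-\tilde{\mathbf{C}}\hat{\boldsymbol\mu}_l^{(m)}\big)^T\Big]+\frac{\gamma_{\mathbf{v}}}{M(L+1)}\mathbf{I}.$$ If $\mathbf{G}$, $\boldsymbol\Sigma_{\mathbf{w}}$, $\boldsymbol\Sigma_0$ and $\boldsymbol\Sigma_{\mathbf{v}}$ are positive-definite, then $\mathcal{P}=(\tilde{\mathbf{V}}_0,\dots,\tilde{\mathbf{V}}_q,\mathbf{c}_0,\boldsymbol\Sigma_{\mathbf{w}},\boldsymbol\Sigma_{\mathbf{v}},\boldsymbol\mu_0,\boldsymbol\Sigma_0)$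 is the unique maximizer, over the set of all admissible parameters, of the regularized evidence lower bound $\mathcal{P}\mapsto\hat L_Q(\mathcal{P})-R(\mathcal{P})$.
   Context: Dimensions and data. Let $n,p,q,M,L$ be integers with $n\ge p\ge1$, $q\ge 0$, $M,L\ge1$. For $m=1,\dots,M$ we are given inputs $\mathbf{u}_l^{(m)}=([\mathbf{u}_l^{(m)}]_0,\dots,[\mathbf{u}_l^{(m)}]_q)^T\in\mathbb{R}^{1+q}$, $0\le l\le L-1$, with $[\mathbf{u}_l^{(m)}]_0=1$, and observations $\mathbf{y}_l^{(m)}\in\mathbb{R}^p$, $0\le l\le L$, collected in $\mathbf{Y}^{(m)}=(\mathbf{y}_0^{(m)},\dots,\mathbf{y}_L^{(m)})$. Let $\tilde{\mathbf{C}}=[\mathbf{I}_p\ \ \mathbf{0}]\in\mathbb{R}^{p\times n}$. Admissible parameters. $\mathcal{P}=(\tilde{\mathbf{V}}_0,\dots,\tilde{\mathbf{V}}_q,\mathbf{c}_0,\boldsymbol\Sigma_{\mathbf{w}},\boldsymbol\Sigma_{\mathbf{v}},\boldsymbol\mu_0,\boldsymbol\Sigma_0)$ with $\tilde{\mathbf{V}}_k\in\mathbb{R}^{(1+n)\times n}$, $\mathbf{c}_0\in\mathbb{R}^p$, $\boldsymbol\mu_0\in\mathbb{R}^n$ arbitrary and $\boldsymbol\Sigma_{\mathbf{w}},\boldsymbol\Sigma_0\in\mathbb{R}^{n\times n}$, $\boldsymbol\Sigma_{\mathbf{v}}\in\mathbb{R}^{p\times p}$ symmetric positive-definite. Matrices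 $\mathbf{A}_l^{(m)},\mathbf{b}_l^{(m)}$. With $\mathbf{V}_k=[\mathbf{0}\ \ \tilde{\mathbf{V}}_k]\in\mathbb{R}^{(1+n)\times(1+n)}$ (first column zero), $\mathbf{A}_l^{(m)}\in\mathbb{R}^{n\times n}$ and $\mathbf{b}_l^{(m)}\in\mathbb{R}^n$ are defined by $$\begin{bmatrix}1&(\mathbf{b}_l^{(m)})^T\\ \mathbf{0}&(\mathbf{A}_l^{(m)})^T\end{bmatrix}=\mathbf{I}+\Delta t\sum_{k=0}^{q}[\mathbf{u}_l^{(m)}]_k\mathbf{V}_k .$$ Model. For each $m$, the hidden Markov model with parameters $\mathcal{P}$ is $$\mathbf{z}_{l+1}=\mathbf{A}_l^{(m)}\mathbf{z}_l+\mathbf{b}_l^{(m)}+\mathbf{w}_l\ (0\le l\le L-1),\qquad \mathbf{y}_l=\mathbf{c}_0+\tilde{\mathbf{C}}\mathbf{z}_l+\mathbf{v}_l\ (0\le l\le L),$$ where $\mathbf{z}_0\sim\mathcal{N}(\boldsymbol\mu_0,\boldsymbol\Sigma_0)$, $\mathbf{w}_l\sim\mathcal{N}(\mathbf{0},\boldsymbol\Sigma_{\mathbf{w}})$, $\mathbf{v}_l\sim\mathcal{N}(\mathbf{0},\boldsymbol\Sigma_{\mathbf{v}})$ are all independent. Let $P^{(m)}_{\mathbf{Z},\mathbf{Y}}(\mathbf{Z},\mathbf{Y};\mathcal{P})$ be the joint probability density of $\mathbf{Z}=(\mathbf{z}_0,\dots,\mathbf{z}_L)$ and $\mathbf{Y}=(\mathbf{y}_0,\dots,\mathbf{y}_L)$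 under this model (it depends on $m$ through the inputs). Inference densities. For each $m$, $Q^{(m)}$ is a fixed probability density on $(\mathbb{R}^n)^{L+1}$ with finite second moments and finite $\mathbb{E}[\log Q^{(m)}(\hat{\mathbf{Z}}^{(m)})]$, where $\hat{\mathbf{Z}}^{(m)}=(\hat{\mathbf{z}}_0^{(m)},\dots,\hat{\mathbf{z}}_L^{(m)})$ is a random variable with density $Q^{(m)}$. Its means and covariances are $$\hat{\boldsymbol\mu}_k^{(m)}=\mathbb{E}[\hat{\mathbf{z}}_k^{(m)}],\qquad \hat{\boldsymbol\Sigma}_{k,l}^{(m)}=\mathbb{E}\big[(\hat{\mathbf{z}}_k^{(m)}-\hat{\boldsymbol\mu}_k^{(m)})(\hat{\mathbf{z}}_l^{(m)}-\hat{\boldsymbol\mu}_l^{(m)})^T\big].$$ Evidence lower bound: $$\hat L_Q(\mathcal{P})=\sum_{m=1}^M\Big\{\mathbb{E}_{\hat{\mathbf{Z}}^{(m)}}\big[\log P^{(m)}_{\mathbf{Z},\mathbf{Y}}(\hat{\mathbf{Z}}^{(m)},\mathbf{Y}^{(m)};\mathcal{P})\big]-\mathbb{E}_{\hat{\mathbf{Z}}^{(m)}}\big[\log Q^{(m)}(\hat{\mathbf{Z}}^{(m)})\big]\Big\}.$$ Regularization: $$R(\mathcal{P})=\frac{\gamma_{\mathbf{G}}}{2}\Delta t^2\sum_{i=0}^{q}\operatorname{Tr}\big(\boldsymbol\Sigma_{\mathbf{w}}^{-1}\tilde{\mathbf{V}}_i^T\tilde{\mathbf{V}}_i\big)+\frac{\gamma_{\mathbf{w}}}{2}\operatorname{Tr}(\boldsymbol\Sigma_{\mathbf{w}}^{-1})+\frac{\gamma_0}{2}\operatorname{Tr}(\boldsymbol\Sigma_0^{-1})+\frac{\gamma_{\mathbf{v}}}{2}\operatorname{Tr}(\boldsymbol\Sigma_{\mathbf{v}}^{-1}).$$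 *)

(* Defs.v *)
From HB Require Import structures.
From mathcomp Require Import all_boot all_order all_algebra.
From mathcomp Require Import all_classical all_reals all_analysis.
From mathcomp Require Import mxtens.

Set Implicit Arguments.
Unset Strict Implicit.
Unset Printing Implicit Defensive.

Import Order.TTheory GRing.Theory Num.Theory.
Import numFieldNormedType.Exports.

Local Open Scope classical_set_scope.
Local Open Scope ring_scope.

(* Real matrices carry the product sigma-algebra, generated by the entries;
   it is the Borel one. *)
Section measurable_matrix.
Context (R : realType) (a b : nat).

Definition mx_cylinders : set (set 'M[R]_(a, b)) :=
  \bigcup_(ij in [set: 'I_a * 'I_b])
    preimage_set_system setT (fun A : 'M[R]_(a, b) => A ij.1 ij.2) measurable.

Let mx_set0 : <<s mx_cylinders >> set0.
Proof. exact: sigma_algebra0. Qed.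

Let mx_setC A : <<s mx_cylinders >> A -> <<s mx_cylinders >> (~` A).
Proof. exact: sigma_algebraC. Qed.

Let mx_bigcup (F : (set 'M[R]_(a, b))^nat) :
  (forall i, <<s mx_cylinders >> (F i)) -> <<s mx_cylinders >> (\bigcup_i F i).
Proof. exact: sigma_algebra_bigcup. Qed.

HB.instance Definition _ := @isMeasurable.Build default_measure_display
  'M[R]_(a, b) <<s mx_cylinders >> mx_set0 mx_setC mx_bigcup.

End measurable_matrix.

Lemma measurable_fun_mxP (R : realType) (a b : nat) d (T : measurableType d)
    (f : T -> 'M[R]_(a, b)) :
  (forall i j, measurable_fun setT (fun t => f t i j)) -> measurable_fun setT f.
Proof.
move=> mf; apply: (@measurability _ _ _ _ _ _ (@mx_cylinders R a b)) => //.
move=> _ [_ [[i j] _ [B mB <-]] <-] /=.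
rewrite setTI -[X in measurable X]setTI.
have := mf i j measurableT B mB.
by rewrite !setTI.
Qed.

(* Image of a measure under a map with a measurable left inverse; the proof
   arguments only serve to infer the sigma-finite measure structure. *)
Definition bij_image d1 d2 (T1 : measurableType d1) (T2 : measurableType d2)
    (R : realType) (mu : set T1 -> \bar R) (f : T1 -> T2) (g : T2 -> T1)
    (_ : measurable_fun setT f) (_ : measurable_fun setT g) (_ : cancel f g) :
  set T2 -> \bar R := pushforward mu f.

Section image_measure.
Context d1 d2 (T1 : measurableType d1) (T2 : measurableType d2) (R : realType).
Variables (mu : {sigma_finite_measure set T1 -> \bar R}) (f : T1 -> T2).
Variable g : T2 -> T1.
Hypotheses (mf : measurable_fun setT f) (mg : measurable_fun setT g).
Hypothesis fK : cancel f g.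

Local Notation nu := (bij_image mu mf mg fK).

Let nu0 : nu set0 = 0%E.
Proof. by rewrite /bij_image /pushforward preimage_set0 measure0. Qed.

Let nu_ge0 A : (0 <= nu A)%E.
Proof. exact: measure_ge0. Qed.

Let nu_sigma_additive : semi_sigma_additive nu.
Proof.
move=> F mF tF mUF; rewrite /bij_image /pushforward preimage_bigcup.
apply: measure_semi_sigma_additive.
- by move=> k; rewrite -[X in measurable X]setTI; exact: mf.
- apply/trivIsetP => /= i j _ _ ij; rewrite -preimage_setI.
  by move/trivIsetP : tF => /(_ _ _ _ _ ij) ->//; rewrite preimage_set0.
- by rewrite -preimage_bigcup -[X in measurable X]setTI; exact: mf.
Qed.

HB.instance Definition _ := isMeasure.Build _ _ _ nu nu0 nu_ge0 nu_sigma_additive.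

Let nu_sigma_finite : sigma_finite setT nu.
Proof.
have [F FT Foo] := sigma_finiteT mu.
exists (fun k => g @^-1` F k).
  by rewrite -preimage_bigcup -FT preimage_setT.
move=> k; have [mF Fk] := Foo k; split.
  by rewrite -[X in measurable X]setTI; exact: mg.
rewrite /bij_image /pushforward -comp_preimage.
by rewrite (_ : g \o f = id)//; apply: funext => x /=; rewrite fK.
Qed.

HB.instance Definition _ :=
  Measure_isSigmaFinite.Build _ _ _ nu nu_sigma_finite.

End image_measure.

(* mu1 \x mu2 again: its canonical sigma-finite structure in the library is
   shadowed by the one for subprobabilities. *)
Section prod_measure.
Context d1 d2 (T1 : measurableType d1) (T2 : measurableType d2) (R : realType).
Variable mu1 : {sigma_finite_measure set T1 -> \bar R}.
Variable mu2 : {sigma_finite_measure set T2 -> \bar R}.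

Definition prod_measure : set (T1 * T2)%type -> \bar R := (mu1 \x mu2)%E.

HB.instance Definition _ := Measure.copy prod_measure (mu1 \x mu2)%E.

Let prod_sigma_finite : sigma_finite setT prod_measure.
Proof.
have /sigma_finiteP[F [TF ndF Foo]] := sigma_finiteT mu1.
have /sigma_finiteP[G [TG ndG Goo]] := sigma_finiteT mu2.
exists (fun k => F k `*` G k).
  rewrite -setXTT TF TG predeqE => -[x y]; split.
    move=> [/= [k _ Fkx] [l _ Gly]]; exists (maxn k l) => //; split.
    - by move: x Fkx; exact/subsetPset/ndF/leq_maxl.
    - by move: y Gly; exact/subsetPset/ndG/leq_maxr.
  by move=> [k _ []/= ? ?]; split; exists k.
move=> k; have [? ?] := Foo k; have [? ?] := Goo k.
split; first exact: measurableX.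
rewrite /prod_measure product_measure1E// lte_mul_pinfty// ge0_fin_numE//.
Qed.

HB.instance Definition _ :=
  Measure_isSigmaFinite.Build _ _ _ prod_measure prod_sigma_finite.

End prod_measure.

Lemma measurable_cons_pair d (T : measurableType d) (k : nat) :
  measurable_fun setT (fun xt : T * k.-tuple T => [tuple of xt.1 :: xt.2]).
Proof. exact: measurable_cons. Qed.

Lemma measurable_uncons d (T : measurableType d) (k : nat) :
  measurable_fun setT
    (fun t : k.+1.-tuple T => (thead t, [tuple of behead t])).
Proof.
apply: measurable_fun_pair; first exact: measurable_tnth.
exact: measurable_behead.
Qed.

Lemma uncons_tupleK T (k : nat) :
  cancel (fun xt : T * k.-tuple T => [tuple of xt.1 :: xt.2])
         (fun t : k.+1.-tuple T => (thead t, [tuple of behead t])).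
Proof. by case=> x t /=; congr pair; apply: val_inj. Qed.

Definition tuple_measureS d (T : measurableType d) (R : realType)
    (mu : {sigma_finite_measure set T -> \bar R}) (k : nat)
    (nu : {sigma_finite_measure set (k.-tuple T) -> \bar R}) :
    {sigma_finite_measure set (k.+1.-tuple T) -> \bar R} :=
  bij_image (prod_measure mu nu) (@measurable_cons_pair d T k)
    (@measurable_uncons d T k) (@uncons_tupleK T k).

(* The k-fold product of mu. *)
Fixpoint tuple_measure d (T : measurableType d) (R : realType)
    (mu : {sigma_finite_measure set T -> \bar R}) (k : nat) :
    {sigma_finite_measure set (k.-tuple T) -> \bar R} :=
  match k with
  | 0 => dirac ([tuple] : 0.-tuple T)
  | k.+1 => tuple_measureS mu (tuple_measure mu k)
  end.

Section lebesgue_mx.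
Context (R : realType) (a b : nat).

Let cols := b.-tuple (a.-tuple (measurableTypeR R)).

Definition mx_of_cols (t : cols) : 'M[R]_(a, b) :=
  \matrix_(i, j) tnth (tnth t j) i.

Definition cols_of_mx (A : 'M[R]_(a, b)) : cols :=
  [tuple [tuple A i j | i < a] | j < b].

Lemma measurable_mx_of_cols : measurable_fun setT mx_of_cols.
Proof.
apply: measurable_fun_mxP => i j.
under eq_fun do rewrite mxE.
apply: (@measurableT_comp _ _ _ _ _ _ (fun x => tnth x i)).
  exact: measurable_tnth.
exact: measurable_tnth.
Qed.

Lemma measurable_mx_coord i j :
  measurable_fun setT (fun A : 'M[R]_(a, b) => A i j).
Proof.
move=> _ B mB; rewrite setTI; apply: sub_sigma_algebra.
by exists (i, j) => //; exists B => //; rewrite setTI.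
Qed.

Lemma measurable_cols_of_mx : measurable_fun setT cols_of_mx.
Proof.
apply/measurable_fun_tnthP => j; apply/measurable_fun_tnthP => i.
apply: (eq_measurable_fun (fun A : 'M[R]_(a, b) => A i j)).
  by move=> A _ /=; rewrite !tnth_mktuple.
exact: measurable_mx_coord.
Qed.

Lemma mx_of_colsK : cancel mx_of_cols cols_of_mx.
Proof.
move=> t; apply: eq_from_tnth => j; apply: eq_from_tnth => i.
by rewrite !tnth_mktuple mxE.
Qed.

(* Lebesgue measure on the space of a x b matrices, that is, on R^(a * b). *)
Definition lebesgue_mx : {sigma_finite_measure set 'M[R]_(a, b) -> \bar R} :=
  bij_image
    (tuple_measure (tuple_measure (@lebesgue_measure R) a) b)
    measurable_mx_of_cols measurable_cols_of_mx mx_of_colsK.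

End lebesgue_mx.

Section probability_notions.
Context (R : realType) d (Omega : measurableType d) (Pr : probability Omega R).

Definition has_density d' (T : measurableType d') (X : Omega -> T)
    (mu : set T -> \bar R) (f : T -> R) : Prop :=
  [/\ measurable_fun setT X, measurable_fun setT f, forall x, 0 <= f x &
      forall A, measurable A ->
        Pr (X @^-1` A) = (\int[mu]_(x in A) (f x)%:E)%E].

Definition independent_families (I : finType) (F : I -> set (set Omega)) :=
  forall (J : {set I}) (E : I -> set Omega),
    (forall i, i \in J -> F i (E i)) ->
    Pr (\bigcap_(i in [set` J]) E i) = (\prod_(i in J) Pr (E i))%E.

Definition sigma_of d' (T : measurableType d') (X : Omega -> T) :=
  preimage_set_system setT X measurable.

End probability_notions.

Definition posdef (R : realType) k (S : 'M[R]_k) : Prop :=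
  S^T = S /\ forall x : 'cV[R]_k, x != 0 -> 0 < (x^T *m S *m x) 0 0.

Definition gauss_pdf (R : realType) k (mu : 'cV[R]_k) (S : 'M[R]_k)
    (x : 'cV[R]_k) : R :=
  expR (- ((x - mu)^T *m invmx S *m (x - mu)) 0 0 / 2)
    / Num.sqrt ((2 * pi) ^+ k * \det S).

(* [X ~ N(mu, S)], for positive-definite S. *)
Definition gaussian (R : realType) d (Omega : measurableType d)
    (Pr : probability Omega R) k (X : Omega -> 'cV[R]_k) mu S : Prop :=
  has_density Pr X (@lebesgue_mx R k 1) (gauss_pdf mu S).

(* For l < L, the indices l and l + 1 in 0..L. *)
Definition cur L (l : 'I_L) : 'I_L.+1 := widen_ord (leqnSn L) l.
Definition nxt L (l : 'I_L) : 'I_L.+1 := lift ord0 l.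

Record params (R : realType) (n p q : nat) := Params {
  par_V : {ffun 'I_(1 + q) -> 'M[R]_(1 + n, n)};
  par_c0 : 'cV[R]_p;
  par_Sw : 'M[R]_n;
  par_Sv : 'M[R]_p;
  par_mu0 : 'cV[R]_n;
  par_S0 : 'M[R]_n
}.

Definition admissible (R : realType) n p q (par : params R n p q) : Prop :=
  [/\ posdef (par_Sw par), posdef (par_S0 par) & posdef (par_Sv par)].

Section model.
Context (R : realType) (n p q L : nat) (dt : R).
Implicit Types (V : {ffun 'I_(1 + q) -> 'M[R]_(1 + n, n)}) (u : 'cV[R]_(1 + q)).

Definition step_mx V u : 'M[R]_(1 + n) :=
  1%:M + dt *: \sum_k u k 0 *: row_mx (0 : 'cV_(1 + n)) (V k).

(* step_mx V u = [1, b^T; 0, A^T] *)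
Definition A_of V u : 'M[R]_n := (drsubmx (step_mx V u))^T.
Definition b_of V u : 'cV[R]_n := (ursubmx (step_mx V u))^T.

(* [I_p 0] *)
Definition Ct : 'M[R]_(p, n) := pid_mx p.

(* A realization of the hidden Markov model with inputs u and parameters par:
   the columns of Z and Y are the states and the observations. *)
Record hmm (u : 'I_L -> 'cV[R]_(1 + q)) (par : params R n p q)
    d (Omega : measurableType d) (Pr : probability Omega R)
    (Z : Omega -> 'M[R]_(n, L.+1)) (Y : Omega -> 'M[R]_(p, L.+1))
    (w : 'I_L -> Omega -> 'cV[R]_n) (v : 'I_L.+1 -> Omega -> 'cV[R]_p) : Prop := {
  hmm_init : gaussian Pr (fun o => col ord0 (Z o)) (par_mu0 par) (par_S0 par);
  hmm_w : forall l, gaussian Pr (w l) 0 (par_Sw par);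
  hmm_v : forall l, gaussian Pr (v l) 0 (par_Sv par);
  hmm_indep : independent_families Pr
    (fun i : option 'I_L + 'I_L.+1 =>
       match i with
       | inl None => sigma_of (fun o => col ord0 (Z o))
       | inl (Some l) => sigma_of (w l)
       | inr l => sigma_of (v l)
       end);
  hmm_state : forall l o, col (nxt l) (Z o) =
    A_of (par_V par) (u l) *m col (cur l) (Z o) + b_of (par_V par) (u l) + w l o;
  hmm_obs : forall l o, col l (Y o) = par_c0 par + Ct *m col l (Z o) + v l o
}.

(* f is the joint density of (Z, Y) under the model. The law of (Z, Y) does not
   depend on the realization; continuity pins the density down pointwise, which
   is needed since it is evaluated at given observations Y. *)
Definition hmm_density (u : 'I_L -> 'cV[R]_(1 + q)) (par : params R n p q)
    (f : 'M[R]_(n, L.+1) * 'M[R]_(p, L.+1) -> R) : Prop :=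
  continuous f /\
  exists d (Omega : measurableType d) (Pr : probability Omega R) Z Y w v,
    @hmm u par d Omega Pr Z Y w v /\
    has_density Pr (fun o => (Z o, Y o))
      (prod_measure (lebesgue_mx R n L.+1) (lebesgue_mx R p L.+1)) f.

End model.

Section moments.
Context (R : realType) d (Omega : measurableType d) (Pr : probability Omega R).
Context (n K : nat) (Z : Omega -> 'M[R]_(n, K)).

Definition mean_col (k : 'I_K) : 'cV[R]_n :=
  \col_i fine ('E_Pr[fun o => Z o i k])%E.

Definition cov_col (k l : 'I_K) : 'M[R]_n :=
  \matrix_(i, j) fine (covariance Pr (fun o => Z o i k) (fun o => Z o j l)).

End moments.

Section objective.
Context (R : realType) (n p q M L : nat) (dt gG gw g0 gv : R).

Definition elbo (P : params R n p q -> 'I_M -> 'M[R]_(n, L.+1) * 'M[R]_(p, L.+1) -> R)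
    (Q : 'I_M -> 'M[R]_(n, L.+1) -> R) (Y : 'I_M -> 'M[R]_(p, L.+1))
    d (Omega : measurableType d) (Pr : probability Omega R)
    (Zh : 'I_M -> Omega -> 'M[R]_(n, L.+1)) (par : params R n p q) : \bar R :=
  (\sum_(m < M) ('E_Pr[fun o => ln (P par m (Zh m o, Y m))]
                 - 'E_Pr[fun o => ln (Q m (Zh m o))]))%E.

Definition regularizer (par : params R n p q) : R :=
  gG / 2 * dt ^+ 2 *
    (\sum_k \tr (invmx (par_Sw par) *m (par_V par k)^T *m par_V par k))
  + gw / 2 * \tr (invmx (par_Sw par))
  + g0 / 2 * \tr (invmx (par_S0 par))
  + gv / 2 * \tr (invmx (par_Sv par)).

End objective.

Section update.
Context (R : realType) (n p q M L : nat) (dt gG gw g0 gv : R).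
Variables (u : 'I_M -> 'I_L -> 'cV[R]_(1 + q)) (Y : 'I_M -> 'M[R]_(p, L.+1)).
Variables (mu : 'I_M -> 'I_L.+1 -> 'cV[R]_n).
Variables (S : 'I_M -> 'I_L.+1 -> 'I_L.+1 -> 'M[R]_n).

(* tensmx is the Kronecker product; the casts identify the dimensions k * 1 and
   1 * k with k. *)
Definition update_G : 'M[R]_((1 + q) * (1 + n)) :=
  \sum_(m < M) \sum_(l < L)
    tensmx (castmx (muln1 _, mul1n _) (tensmx (u m l) (u m l)^T))
      (block_mx 1%:M (mu m (cur l))^T
                (mu m (cur l))
                (S m (cur l) (cur l) + mu m (cur l) *m (mu m (cur l))^T))
  + gG%:M.

Definition update_H : 'M[R]_(n, (1 + q) * (1 + n)) :=
  \sum_(m < M) \sum_(l < L)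
    castmx (mul1n _, erefl)
      (tensmx (u m l)^T
        (row_mx (dt^-1 *: (mu m (nxt l) - mu m (cur l)))
                (dt^-1 *: (S m (nxt l) (cur l) - S m (cur l) (cur l))
                 + (dt^-1 *: (mu m (nxt l) - mu m (cur l)))
                   *m (mu m (cur l))^T))).

(* [V_0^T ... V_q^T] = H G^-1: V_k^T is the k-th block of 1 + n columns. *)
Definition update_V : {ffun 'I_(1 + q) -> 'M[R]_(1 + n, n)} :=
  [ffun k => (colsub (fun j => mxtens_index (k, j))
                     (update_H *m invmx update_G))^T].

Let A m l := A_of dt update_V (u m l).
Let b m l := b_of dt update_V (u m l).

Definition update_Sw : 'M[R]_n :=
  (M%:R * L%:R)^-1 *: (\sum_(m < M) \sum_(l < L)
    (S m (nxt l) (nxt l) - A m l *m S m (cur l) (nxt l)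
     - S m (nxt l) (cur l) *m (A m l)^T
     + A m l *m S m (cur l) (cur l) *m (A m l)^T
     + (mu m (nxt l) - A m l *m mu m (cur l) - b m l)
       *m (mu m (nxt l) - A m l *m mu m (cur l) - b m l)^T))
  + (gG * dt ^+ 2 / (M%:R * L%:R)) *: (\sum_k (update_V k)^T *m update_V k)
  + (gw / (M%:R * L%:R))%:M.

Definition update_mu0 : 'cV[R]_n := M%:R^-1 *: \sum_(m < M) mu m ord0.

Definition update_S0 : 'M[R]_n :=
  M%:R^-1 *: (\sum_(m < M)
    (S m ord0 ord0 + (mu m ord0 - update_mu0) *m (mu m ord0 - update_mu0)^T))
  + (g0 / M%:R)%:M.

Local Notation C := (Ct R n p).

Definition update_c0 : 'cV[R]_p :=
  (M%:R * L.+1%:R)^-1 *: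
    \sum_(m < M) \sum_(l < L.+1) (col l (Y m) - C *m mu m l).

Definition update_Sv : 'M[R]_p :=
  (M%:R * L.+1%:R)^-1 *: (\sum_(m < M) \sum_(l < L.+1)
    (C *m S m l l *m C^T
     + (col l (Y m) - update_c0 - C *m mu m l)
       *m (col l (Y m) - update_c0 - C *m mu m l)^T))
  + (gv / (M%:R * L.+1%:R))%:M.

Definition update : params R n p q :=
  Params update_V update_c0 update_Sw update_Sv update_mu0 update_S0.

End update.

Definition is_maximizer (R : realType) T (D : T -> Prop) (f : T -> \bar R) (x : T) :=
  D x /\ forall y, D y -> (f y <= f x)%E.

(* Main.v *)
(* The residuals z_0, z_{l+1} - A_l z_l - b_l, y_l - c_0 - C z_l of the model are
   independent Gaussians, and they determine (Z, Y) by a volume-preserving affine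
   change of variables. Comparing the mass and the volume of small boxes in the
   residuals therefore identifies the continuous joint density with the product
   of the Gaussian densities of the residuals.

   Up to a constant, -2 times the regularized bound is then a sum of three terms
   N log det S + Tr (S^-1 W(X)), one for each of the pairs (S_w, V), (S_0, mu_0)
   and (S_v, c_0), where W(X) is the regularized second moment of the residual of
   a linear regression with coefficients X. Completing the square gives
   W(X) = W(X') + c (X - X') G (X - X')^T with G positive-definite and X' the
   updated coefficients, and W(X') = N S' for the updated covariance S'. So the
   term is minimal exactly at X = X' and S = S', by the inequality
   log det W + k <= log det S + Tr (S^-1 W). *)

Require Import Defs.
From mathcomp Require Import all_boot all_order all_algebra.
From mathcomp Require Import all_classical all_reals all_analysis.
From mathcomp Require Import measurable_realfun mxtens ring lra.

Set Implicit Arguments.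
Unset Strict Implicit.
Unset Printing Implicit Defensive.

Import Order.TTheory GRing.Theory Num.Theory.
Import numFieldNormedType.Exports.

Local Open Scope classical_set_scope.
Local Open Scope ring_scope.

(** * Positive-definite matrices *)

(** Boxes stand in for a general change of variables: the map from (Z, Y) to the residuals is unit
    triangular column by column, so Fubini alone gives the volume of a box, while independence gives
    its mass. The state equation is a regression because A z + b = z + dt V (u \otimes (1, z)),
    where V is the row of the blocks V_k^T. Hence G is the second moment of the inputs u \otimes (1,
    z) plus the ridge gG, H is their cross moment with the difference quotients (z_{l+1} - z_l) /
    dt, and the constant c is dt^2 for the states. The penalty on V is weighted by S_w^-1, which is
    what lets it enter W as a ridge. S and X can be optimized jointly in closed form because X' does
    not involve S: W(X) - W(X') is positive-semidefinite, so X' minimizes Tr (S^-1 W(X)) for every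
    S. *)

Section linear_algebra.
Context (R : realType).

Lemma mxtrace_sqr_ge0 a b (X : 'M[R]_(a, b)) : 0 <= \tr (X *m X^T).
Proof.
apply: sumr_ge0 => i _; rewrite mxE; apply: sumr_ge0 => j _.
by rewrite mxE -expr2 sqr_ge0.
Qed.

Lemma mxtrace_sqr_eq0 a b (X : 'M[R]_(a, b)) : \tr (X *m X^T) = 0 -> X = 0.
Proof.
move=> /eqP; rewrite /mxtrace psumr_eq0; last first.
  by move=> i _; rewrite mxE; apply: sumr_ge0 => j _; rewrite mxE -expr2 sqr_ge0.
move=> /allP h; apply/matrixP => i j; rewrite mxE.
have := h i (mem_index_enum _); rewrite /= mxE psumr_eq0; last first.
  by move=> l _; rewrite mxE -expr2 sqr_ge0.
move=> /allP/(_ j (mem_index_enum _)) /=.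
by rewrite mxE -expr2 sqrf_eq0 => /eqP.
Qed.

Lemma posdef_schur k (S : 'M[R]_(1 + k)) : posdef S ->
  exists a : R, exists v : 'cV[R]_k, exists D : 'M[R]_k,
  [/\ 0 < a, S = block_mx a%:M v^T v D & posdef (D - a^-1 *: (v *m v^T))].
Proof.
move=> [St Sp]; pose a := S 0 0; pose v := dlsubmx S.
exists a, v, (drsubmx S).
have a_gt0 : 0 < a.
  have := Sp (delta_mx 0 0).
  rewrite trmx_delta -rowE -colE !mxE; apply.
  by apply/eqP => /matrixP/(_ 0 0); rewrite !mxE !eqxx; apply/eqP; rewrite oner_eq0.
have Sdr : (drsubmx S)^T = drsubmx S by rewrite trmx_drsub St.
have Sblock : S = block_mx a%:M v^T v (drsubmx S).
  rewrite -[LHS]submxK; congr block_mx; last by rewrite trmx_dlsub St.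
  by rewrite [LHS]mx11_scalar !mxE !lshift0.
split=> //; split.
  by rewrite linearB linearZ /= trmx_mul trmxK Sdr.
move=> x x0.
(* This first coordinate minimizes the form for given x: the top entry of S y vanishes, and what
   remains is the Schur complement at x. *)
set y := col_mx (- a^-1 *: (v^T *m x)) x.
have y0 : y != 0.
  by apply: contra_neq x0 => y0; rewrite -(col_mxKd (- a^-1 *: (v^T *m x)) x) -/y y0 linear0.
have := Sp y y0; rewrite Sblock /y tr_col_mx -mulmxA mul_block_col mul_row_col.
rewrite mul_scalar_mx scalerA mulrN divff ?gt_eqF// scaleN1r addNr mulmx0 add0r.
by rewrite block_mxKdr -[_ *m x in X in _ -> X]mulmxA mulmxBl -scalemxAl -scalemxAr scaleNr mulmxA addrC.
Qed.

(** Induction through the Schur complement: the first column of T is (sqrt a, v / sqrt a), and the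
    remaining block factors the complement. The triangular factor replaces eigenvalues everywhere
    below, since determinant and trace are explicit in its entries. *)
Lemma posdef_cholesky k (S : 'M[R]_k) : posdef S ->
  exists T : 'M[R]_k, [/\ S = T *m T^T, is_trig_mx T & forall i, 0 < T i i].
Proof.
elim: k S => [|k IH]; last rewrite -[k.+1]/(1 + k)%N; move=> S pS.
  exists 0; split; [by rewrite !flatmx0| |by case].
  by apply/is_trig_mxP; case.
have [a [v [D [a0 Sblock /IH[T [TE Ttrig Tp]]]]]] := posdef_schur pS.
exists (block_mx (Num.sqrt a)%:M 0 ((Num.sqrt a)^-1 *: v) T); split.
- rewrite [LHS]Sblock tr_block_mx mulmx_block !trmx0 !mul0mx !mulmx0 !addr0.
  rewrite tr_scalar_mx -scalar_mxM -expr2 sqr_sqrtr ?ltW//.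
  rewrite mul_mx_scalar linearZ/= scalerA mul_scalar_mx scalerA.
  have s0 : Num.sqrt a != 0 by rewrite gt_eqF// sqrtr_gt0.
  rewrite divff// scale1r -TE -scalemxAl -scalemxAr scalerA -invfM -expr2.
  by rewrite sqr_sqrtr ?ltW// scale1r addrC subrK.
- by rewrite is_trig_block_mx// eqxx scalar_mx_is_trig.
- move=> i; case: (split_ordP i) => j ->.
    by rewrite block_mxEul ord1 mxE eqxx mulr1n sqrtr_gt0.
  by rewrite block_mxEdr.
Qed.

Lemma posdef_det_gt0 k (S : 'M[R]_k) : posdef S -> 0 < \det S.
Proof.
move=> /posdef_cholesky[T [-> Tt Tp]]; rewrite det_mulmx det_tr det_trig//.
by rewrite mulr_gt0// prodr_gt0.
Qed.

Lemma posdef_unit k (S : 'M[R]_k) : posdef S -> S \in unitmx.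
Proof. by move=> /posdef_det_gt0 d0; rewrite unitmxE unitfE gt_eqF. Qed.

Lemma posdef_congr k (S T : 'M[R]_k) :
  T \in unitmx -> posdef S -> posdef (T *m S *m T^T).
Proof.
move=> uT [St Sp]; split; first by rewrite !trmx_mul trmxK St mulmxA.
move=> x x0; rewrite !mulmxA -mulmxA -[x^T *m T]trmxK trmx_mul trmxK.
apply: Sp; apply: contra_neq x0 => /(congr1 (mulmx (invmx T^T))).
by rewrite mulmx0 mulKmx// unitmx_tr.
Qed.

(** S^-1 is congruent to S, as S^-1 = S^-1 S (S^-1)^T. *)
Lemma posdef_inv k (S : 'M[R]_k) : posdef S -> posdef (invmx S).
Proof.
move=> pS; have uS := posdef_unit pS.
rewrite -[invmx S](mulmxK uS) -{3}[S](proj1 pS) -mulmxA.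
rewrite (_ : S *m invmx S^T = S *m (invmx S)^T); last by rewrite trmx_inv.
rewrite mulmxA; apply: posdef_congr => //; by rewrite unitmx_inv.
Qed.

Lemma posdef1 k : posdef (1%:M : 'M[R]_k).
Proof.
split=> [|x x0]; first exact: trmx1.
rewrite mulmx1 -trace_mx11 mxtrace_mulC lt_neqAle mxtrace_sqr_ge0 andbT eq_sym.
by apply: contra_neq x0 => /mxtrace_sqr_eq0.
Qed.

(** With S = U U^T and G = T T^T, the trace is the squared Frobenius norm of U^T X T, and U and T
    are invertible. *)
Lemma mxtrace_posdef a b (S : 'M[R]_a) (G : 'M[R]_b) (X : 'M[R]_(a, b)) :
  posdef S -> posdef G ->
  0 <= \tr (S *m (X *m G *m X^T)) /\
  (\tr (S *m (X *m G *m X^T)) = 0 -> X = 0).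
Proof.
move=> pS pG.
have [U [SE _ _]] := posdef_cholesky pS; have [T [GE _ _]] := posdef_cholesky pG.
have -> : \tr (S *m (X *m G *m X^T)) =
    \tr ((U^T *m X *m T) *m (U^T *m X *m T)^T).
  by rewrite SE GE !trmx_mul trmxK -mulmxA mxtrace_mulC !mulmxA mxtrace_mulC !mulmxA.
split; first exact: mxtrace_sqr_ge0.
have := posdef_unit pS; rewrite {1}SE unitmx_mul => /andP[_ uU].
have := posdef_unit pG; rewrite {1}GE unitmx_mul => /andP[uT _].
move=> /mxtrace_sqr_eq0 /(congr1 (mulmx^~ (invmx T))).
rewrite mulmxK// mul0mx => /(congr1 (mulmx (invmx U^T))).
by rewrite mulKmx// mulmx0.
Qed.

Lemma ln_le_subr1 (x : R) : 0 < x -> ln x <= x - 1 /\ (ln x = x - 1 -> x = 1).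
Proof.
move=> x0; have xE : x = expR (ln x) by rewrite lnK.
split.
  by rewrite lerBrDl {2}xE; exact: expR_ge1Dx.
move=> lE; apply/eqP; apply: contraT => x1.
have : ln x != 0 by rewrite ln_eq0.
by move=> /expR_gt1Dx; rewrite -xE lE addrC subrK ltxx.
Qed.

Lemma ln_prod (I : finType) (F : I -> R) : (forall i, 0 < F i) ->
  ln (\prod_i F i) = \sum_i ln (F i).
Proof.
move=> F0; rewrite -[RHS]expRK expR_sum; congr ln.
by apply: eq_bigr => i _; rewrite lnK ?posrE.
Qed.

(* With a Cholesky factor T, both sides are sums over the entries of T. *)
Lemma ln_det_le_mxtrace k (B : 'M[R]_k) : posdef B ->
  ln (\det B) <= \tr B - k%:R /\ (ln (\det B) = \tr B - k%:R -> B = 1%:M).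
Proof.
move=> /posdef_cholesky[T [-> Tt Tp]].
have T2 i : 0 < T i i ^+ 2 by rewrite exprn_gt0.
have lnE : ln (\det (T *m T^T)) = \sum_i ln (T i i ^+ 2).
  rewrite det_mulmx det_tr det_trig// -big_split /= -ln_prod//.
have trE : \tr (T *m T^T) - k%:R =
    \sum_i (T i i ^+ 2 - 1 + \sum_(j | j != i) T i j ^+ 2).
  rewrite big_split /= sumrB sumr_const card_ord addrAC -big_split /=.
  congr (_ - _); apply: eq_bigr => i _.
  rewrite mxE (bigD1 i)//= mxE -expr2; congr (_ + _).
  by apply: eq_bigr => j _; rewrite mxE -expr2.
(* Each summand has two nonnegative gaps, that of ln x <= x - 1 on the diagonal and the squares off
   the diagonal. Equality closes all of them, which forces T = 1. *)
have le1 i : ln (T i i ^+ 2) <= T i i ^+ 2 - 1 + \sum_(j | j != i) T i j ^+ 2.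
  rewrite -[leLHS]addr0 lerD//; first by have [] := ln_le_subr1 (T2 i).
  by apply: sumr_ge0 => j _; exact: sqr_ge0.
rewrite lnE trE; split; first exact: ler_sum.
move=> /eqP; rewrite eq_sym -subr_eq0 -sumrB psumr_eq0; last first.
  by move=> i _; rewrite subr_ge0.
move=> /allP h.
suff -> : T = 1%:M by rewrite trmx1 mulmx1.
have {}h i : T i i ^+ 2 - 1 - ln (T i i ^+ 2) = 0 /\ \sum_(j | j != i) T i j ^+ 2 = 0.
  have := h i (mem_index_enum _); rewrite /= addrAC paddr_eq0.
  - by move=> /andP[/eqP ? /eqP].
  - by rewrite subr_ge0; have [] := ln_le_subr1 (T2 i).
  - by apply: sumr_ge0 => j _; exact: sqr_ge0.
apply/matrixP => i j; rewrite mxE eq_sym; have [hi /eqP] := h i.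
case: (eqVneq j i) => [-> _|ji].
  have /(proj2 (ln_le_subr1 (T2 i))) /eqP : ln (T i i ^+ 2) = T i i ^+ 2 - 1.
    by apply/eqP; rewrite eq_sym -subr_eq0 hi.
  by rewrite sqrp_eq1 ?ltW// => /eqP.
rewrite psumr_eq0; last by move=> l _; exact: sqr_ge0.
by move=> /allP/(_ j (mem_index_enum _)); rewrite ji /= sqrf_eq0 => /eqP.
Qed.

(** Conjugation by a Cholesky factor T of S reduces to the case S = 1: the matrix B = T^-1 W T^-T
    has trace Tr (S^-1 W) and determinant det W / det S. *)
Lemma ln_det_mxtrace_min k (S W : 'M[R]_k) : posdef S -> posdef W ->
  ln (\det W) + k%:R <= ln (\det S) + \tr (invmx S *m W) /\
  (ln (\det W) + k%:R = ln (\det S) + \tr (invmx S *m W) -> S = W).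
Proof.
move=> pS pW; have [T [SE _ _]] := posdef_cholesky pS.
have dS := posdef_det_gt0 pS; have dW := posdef_det_gt0 pW.
have := posdef_unit pS; rewrite {1}SE unitmx_mul => /andP[uT uTt].
set B := invmx T *m W *m (invmx T)^T.
have pB : posdef B by apply: posdef_congr; rewrite ?unitmx_inv.
have invS : invmx S = (invmx T)^T *m invmx T.
  rewrite -[RHS](mulmxK (posdef_unit pS)) [X in X *m _](_ : _ = 1%:M) ?mul1mx//.
  by rewrite SE -mulmxA mulKmx// -trmx_mul mulmxV// trmx1.
have trB : \tr B = \tr (invmx S *m W).
  by rewrite /B mxtrace_mulC invS mulmxA.
have detB : ln (\det B) = ln (\det W) - ln (\det S).
  rewrite -ln_div ?posrE//; congr ln.
  rewrite /B !det_mulmx det_tr det_inv SE det_mulmx det_tr mulrAC invfM.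
  by rewrite mulrC mulrA.
have [h1 h2] := ln_det_le_mxtrace pB; rewrite trB detB in h1 h2; split.
  by move: h1; lra.
move=> h; have : B = 1%:M by apply: h2; move: h; lra.
move=> BE; have : T *m B *m T^T = S by rewrite BE mulmx1.
by rewrite /B -!mulmxA -trmx_mul mulmxV// trmx1 mulmx1 mulKVmx.
Qed.

End linear_algebra.

(** * The joint density *)

Lemma add_entry (R : realType) a b (A B : 'M[R]_(a, b)) i j :
  (A + B) i j = A i j + B i j.
Proof. by rewrite mxE. Qed.

Lemma opp_entry (R : realType) a b (A : 'M[R]_(a, b)) i j :
  (- A) i j = - A i j.
Proof. by rewrite mxE. Qed.

Lemma sub_entry (R : realType) a b (A B : 'M[R]_(a, b)) i j :
  (A - B) i j = A i j - B i j.
Proof. by rewrite !mxE. Qed.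

Lemma col_entry (R : realType) a b (A : 'M[R]_(a, b)) j i k :
  col j A i k = A i j.
Proof. by rewrite mxE. Qed.

Section measure_boxes.
Context (R : realType).

Lemma measurable_forall d (T : measurableType d) (I : finType)
    (A : I -> set T) :
  (forall i, measurable (A i)) -> measurable [set t | forall i, A i t].
Proof.
move=> mA; rewrite (_ : [set t | _] = \bigcap_(i in [set: I]) A i).
  by apply: fin_bigcap_measurable => //; exact: finite_finset.
by apply/seteqP; split=> t /= h i; [move=> _; exact: h|exact: h].
Qed.

(** Fubini for sections that move with the first coordinate but keep their measure. It serves for
    boxes of observations, whose centre depends on the states. *)
Lemma prod_measure_sections d1 d2 (T1 : measurableType d1)
    (T2 : measurableType d2)
    (mu1 : {sigma_finite_measure set T1 -> \bar R})
    (mu2 : {sigma_finite_measure set T2 -> \bar R})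
    (A : set T1) (B : T1 -> set T2) (c : R) :
  measurable A -> (forall x, A x -> mu2 (B x) = c%:E) ->
  prod_measure mu1 mu2 [set z | A z.1 /\ B z.1 z.2] = (c%:E * mu1 A)%E.
Proof.
move=> mA muB.
rewrite /prod_measure /product_measure1 -integral_cst// [RHS]integral_mkcond.
apply: eq_integral => x _ /=; rewrite patchE; case: ifPn.
  rewrite inE => Ax; rewrite -(muB _ Ax); congr (mu2 _).
  by apply/seteqP; split=> y; rewrite /xsection /= inE /= => // -[].
move=> /negP; rewrite inE => nAx.
rewrite (_ : xsection _ _ = set0) ?measure0//.
by apply/seteqP; split=> y //; rewrite /xsection /= inE /= => -[].
Qed.

(* The condition on the l-th coordinate may depend on the previous ones, as long
   as the measure of the set of its solutions does not. *)
Lemma tuple_measure_triangular d (T : measurableType d)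
    (mu : {sigma_finite_measure set T -> \bar R}) (c : R) (k : nat)
    (D : 'I_k -> k.-tuple T -> set T) :
  (forall (l : 'I_k) t t', (forall j : 'I_k, (j < l)%N -> tnth t j = tnth t' j) ->
     D l t = D l t') ->
  (forall l, measurable [set t | D l t (tnth t l)]) ->
  (forall l t, mu (D l t) = c%:E) ->
  tuple_measure mu k [set t | forall l, D l t (tnth t l)] = (c ^+ k)%:E.
Proof.
elim: k D => [|k IH] D DE mD muD.
  rewrite /= (_ : [set t | _] = setT) ?probability_setT//.
  by apply/seteqP; split=> // t _ [].
(* The condition on the first coordinate has no predecessors, so it can be evaluated at an arbitrary
   tuple. *)
pose t0 : k.+1.-tuple T := [tuple point | _ < k.+1].
have D0 t : D ord0 t = D ord0 t0 by exact: DE.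
pose B x (t : k.-tuple T) :=
  forall l : 'I_k, D (lift ord0 l) [tuple of x :: t] (tnth t l).
have muB x : tuple_measure mu k (B x) = (c ^+ k)%:E.
  apply: (IH (fun l t => D (lift ord0 l) [tuple of x :: t])).
  - move=> l t t' tt'; apply: DE => j; case: (unliftP ord0 j) => [j' ->|-> _].
      by rewrite !lift0 ltnS !tnthS => /tt'.
    by rewrite !tnth0.
  - move=> l; rewrite -[X in measurable X]setTI.
    have mx : measurable_fun setT (fun t : k.-tuple T => [tuple of x :: t]).
      by apply: measurable_cons => //; exact: measurable_cst.
    have := mx measurableT _ (mD (lift ord0 l)).
    congr measurable; congr (_ `&` _).
    by apply/seteqP; split=> t; rewrite /preimage /= tnthS.
  - by move=> l t; exact: muD.
rewrite [LHS]/(prod_measure mu (tuple_measure mu k) _).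
rewrite (_ : _ @^-1` _ = [set z | D ord0 t0 z.1 /\ B z.1 z.2]).
  transitivity ((c ^+ k)%:E * mu (D ord0 t0))%E; last first.
    by rewrite muD exprS mulrC EFinM.
  apply: prod_measure_sections.
  (* The first condition as a set of points x is the preimage of a measurable set of tuples under x
     |-> (x, ..., x). *)
  - have mx : measurable_fun setT (fun x : T => nseq_tuple k.+1 x).
      apply/measurable_fun_tnthP => i.
      apply: (eq_measurable_fun id) => // x _ /=.
      by rewrite (tnth_nth x) nth_nseq ltn_ord.
    have := mx measurableT _ (mD ord0); rewrite setTI; congr measurable.
    by apply/seteqP; split=> x; rewrite /preimage /= D0 (tnth_nth x).
  - by move=> x _; exact: muB.
apply/seteqP; split=> -[x t] /=.
  move=> h; split; first by have := h ord0; rewrite D0 tnth0.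
  by move=> l; have := h (lift ord0 l); rewrite tnthS.
move=> [h1 h2] l; case: (unliftP ord0 l) => [l' ->|->].
  by rewrite tnthS; exact: h2.
by rewrite D0 tnth0.
Qed.

(** * Densities as limits over small boxes *)

Definition box (I T : Type) (g : I -> T -> R) (r : I -> R) (e : R) : set T :=
  [set t | forall i, `|g i t - r i| < e].

(** Convergence along this filter is convergence of every coordinate [g i] to [r i]. It says
    something about the point itself only when the coordinates determine the point continuously,
    which has to be shown for the residuals. *)
Definition box_filter (I T : Type) (g : I -> T -> R) (r : I -> R) :=
  filter_from [set e : R | 0 < e] (box g r).

Lemma subset_box (I T : Type) (g : I -> T -> R) r e e' :
  e <= e' -> box g r e `<=` box g r e'.
Proof. by move=> ee' t h i; exact: lt_le_trans (h i) ee'. Qed.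

Global Instance box_filter_filter (I T : Type) (g : I -> T -> R) r :
  Filter (box_filter g r).
Proof.
apply: filter_from_filter; first by exists 1; exact: ltr01.
move=> e e' /= e0 e'0; exists (Num.min e e'); first by rewrite /= lt_min e0.
by move=> t h; split; apply: subset_box h; rewrite ge_min lexx ?orbT.
Qed.

Lemma cvg_box_filter (I T : Type) (g : I -> T -> R) r i :
  g i t @[t --> box_filter g r] --> r i.
Proof.
apply/cvgrPdist_le => e e0; exists e => //= t h.
by rewrite distrC ltW.
Qed.

Lemma measurable_dist_lt d (T : measurableType d) (f h : T -> R) e :
  measurable_fun setT f -> measurable_fun setT h ->
  measurable [set t | `|f t - h t| < e].
Proof.
move=> mf mh.
rewrite (_ : [set t | _] = (fun t => `|f t - h t|) @^-1` `]-oo, e[).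
  rewrite -[X in measurable X]setTI.
  apply: (measurableT_comp (f := @Num.norm _ R)) => //; exact: measurable_funB.
by apply/seteqP; split=> t /=; rewrite in_itv.
Qed.

Lemma measurable_box d (T : measurableType d) (I : finType)
    (g : I -> T -> R) r e :
  (forall i, measurable_fun setT (g i)) -> measurable (box g r e).
Proof.
by move=> mg; apply: measurable_forall => i; exact: measurable_dist_lt.
Qed.

(** On a small box the density is within eps of a, so the mass lies between a - eps and a + eps
    times the volume. *)
Lemma has_density_box_ratio d (Omega : measurableType d)
    (Pr : probability Omega R) d' (T : measurableType d') (X : Omega -> T)
    (mu : {measure set T -> \bar R}) (f : T -> R)
    (I : finType) (g : I -> T -> R) r (v : R -> R) (a : R) :
  has_density Pr X mu f ->
  (forall i, measurable_fun setT (g i)) ->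
  (forall e, 0 < e -> 0 < v e) ->
  (forall e, 0 < e -> mu (box g r e) = (v e)%:E) ->
  f t @[t --> box_filter g r] --> a ->
  fine (Pr (X @^-1` box g r e)) / v e @[e --> 0^'+] --> a.
Proof.
move=> [mX mf f0 Prf] mg v0 muv /cvgrPdist_le fa.
apply/cvgrPdist_le => eps eps0.
have [e0 /= e0_gt0 fe0] := fa _ eps0.
near=> e.
have e_gt0 : 0 < e by near: e; exact: nbhs_right_gt.
have ee0 : e <= e0 by near: e; exact: nbhs_right_le.
have mB : measurable (box g r e) by exact: measurable_box.
have fe t : box g r e t -> a - eps <= f t <= a + eps.
  by move=> Bt; have := fe0 _ (subset_box ee0 Bt); rewrite /= distrC ler_distl.
have PE := Prf _ mB.
have Pfin : Pr (X @^-1` box g r e) \is a fin_num.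
  apply: fin_num_measure; rewrite -[X in measurable X]setTI; exact: mX.
have mfB : measurable_fun (box g r e) (fun t => (f t)%:E).
  by apply/measurable_EFinP; apply: measurable_funTS.
have ve := v0 _ e_gt0.
(* The lower bound is truncated at 0 because the integrals are compared for nonnegative functions,
   while a - eps may be negative. *)
suff : Num.max 0 (a - eps) * v e <= fine (Pr (X @^-1` box g r e)) <= (a + eps) * v e.
  move=> /andP[h1 h2]; rewrite distrC ler_distl ler_pdivlMr// ler_pdivrMr// h2 andbT.
  by apply: le_trans h1; rewrite ler_pM2r// le_max lexx orbT.
rewrite -!lee_fin fineK// PE !EFinM -(muv _ e_gt0) -!integral_cst//.
apply/andP; split; apply: ge0_le_integral => //=.
- by move=> t _; rewrite lee_fin le_max lexx.
- by move=> t Bt; rewrite lee_fin ge_max f0; have /andP[] := fe _ Bt.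
- by move=> t _; rewrite lee_fin.
- by move=> t Bt; rewrite lee_fin; have /andP[] := fe _ Bt.
Unshelve. all: by end_near. Qed.

(** Given the columns before l, the condition on column l is a translated cube, of volume (2e)^a
    whatever the translation. So subtracting a prediction from the past preserves the volume of
    boxes. *)
Lemma lebesgue_mx_triangular a b (pred : 'M[R]_(a, b) -> 'M[R]_(a, b))
    (r : 'I_a * 'I_b -> R) e :
  0 <= e ->
  (forall Z Z' (l : 'I_b), (forall j : 'I_b, (j < l)%N -> col j Z = col j Z') ->
     col l (pred Z) = col l (pred Z')) ->
  (forall i l, measurable_fun setT (fun Z => pred Z i l)) ->
  lebesgue_mx R a b (box (fun il Z => (Z - pred Z) il.1 il.2) r e) =
    (((e *+ 2) ^+ a) ^+ b)%:E.
Proof.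
move=> e0 pE mpred.
pose D (l : 'I_b) (t : b.-tuple (a.-tuple (measurableTypeR R))) :=
  [set y : a.-tuple (measurableTypeR R) |
    forall i, ball (r (i, l) + pred (mx_of_cols t) i l) e (tnth y i)].
transitivity (tuple_measure (tuple_measure (@lebesgue_measure R) a) b
    [set t | forall l, D l t (tnth t l)]).
  rewrite [LHS]/(tuple_measure _ _ _); congr (tuple_measure _ _ _).
  apply/seteqP; split=> t; rewrite /preimage /D /= /box /= /ball /=.
    by move=> h l i; have := h (i, l); rewrite !mxE /= distrC opprB addrA.
  by move=> h [i l]; rewrite distrC; have := h l i; rewrite !mxE /= opprB addrA.
apply: tuple_measure_triangular.
- move=> l t t' tt'; rewrite /D; apply/seteqP.
  suff pp i : pred (mx_of_cols t) i l = pred (mx_of_cols t') i l.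
    by split=> y /= h i; have := h i; rewrite pp.
  have /pE/matrixP/(_ i 0) : forall j : 'I_b, (j < l)%N ->
      col j (mx_of_cols t) = col j (mx_of_cols t').
    by move=> j /tt' tj; apply/matrixP => i' k; rewrite !mxE tj.
  by rewrite !mxE.
- move=> l; rewrite /D /=.
  apply: measurable_forall => i; apply: measurable_dist_lt.
    apply: measurable_funD => //; apply: (measurableT_comp (mpred i l)).
    exact: measurable_mx_of_cols.
  apply: (measurableT_comp (f := fun x => tnth x i)); exact: measurable_tnth.
- move=> l t.
  (* Inside one column the prediction is already fixed, so the conditions on its entries do not
     interact. *)
  apply: (tuple_measure_triangular (D := fun i _ =>
     ball (r (i, l) + pred (mx_of_cols t) i l) e : set (measurableTypeR R))).
  + by [].
  + move=> i; apply: measurable_dist_lt => //; exact: measurable_tnth.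
  + by move=> i _; exact: lebesgue_measure_ball.
Qed.

Lemma cvg_bigsum (I T : Type) (F : set_system T) {FF : Filter F} (s : seq I)
    (f : I -> T -> R) (a : I -> R) :
  (forall i, f i t @[t --> F] --> a i) ->
  \sum_(i <- s) f i t @[t --> F] --> \sum_(i <- s) a i.
Proof.
move=> fa; elim: s => [|i s IH].
  by under eq_fun do rewrite big_nil; rewrite big_nil; exact: cvg_cst.
by under eq_fun do rewrite big_cons; rewrite big_cons; exact: cvgD.
Qed.

Lemma cvg_bigprod (I T : Type) (F : set_system T) {FF : Filter F} (s : seq I)
    (f : I -> T -> R) (a : I -> R) :
  (forall i, f i t @[t --> F] --> a i) ->
  \prod_(i <- s) f i t @[t --> F] --> \prod_(i <- s) a i.
Proof.
move=> fa; elim: s => [|i s IH].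
  by under eq_fun do rewrite big_nil; rewrite big_nil; exact: cvg_cst.
by under eq_fun do rewrite big_cons; rewrite big_cons; exact: cvgM.
Qed.

Lemma cvg_mxE (T : Type) (F : set_system T) {FF : Filter F} a b
    (X : T -> 'M[R]_(a, b)) (x : 'M[R]_(a, b)) :
  (forall i j, X t i j @[t --> F] --> x i j) -> X t @[t --> F] --> x.
Proof.
move=> Xx; apply/cvg_ballP => e e0.
have h : \forall t \near F, forall ij : 'I_a * 'I_b,
    ball (x ij.1 ij.2) e (X t ij.1 ij.2).
  by apply: filter_forall => ij; move/cvg_ballP : (Xx ij.1 ij.2); exact.
by apply: filterS h => t h; split=> // i j; exact: (h (i, j)).
Qed.

Lemma cvg_mulmxE (T : Type) (F : set_system T) {FF : Filter F} a b c
    (X : T -> 'M[R]_(a, b)) (x : 'M[R]_(a, b))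
    (Y : T -> 'M[R]_(b, c)) (y : 'M[R]_(b, c)) :
  (forall i j, X t i j @[t --> F] --> x i j) ->
  (forall i j, Y t i j @[t --> F] --> y i j) ->
  forall i j, (X t *m Y t) i j @[t --> F] --> (x *m y) i j.
Proof.
move=> Xx Yy i j; under eq_fun do rewrite mxE; rewrite mxE.
by apply: cvg_bigsum => k; exact: cvgM.
Qed.

Lemma cvg_gauss_pdf (T : Type) (F : set_system T) {FF : Filter F} k
    (mu : 'cV[R]_k) (S : 'M[R]_k) (X : T -> 'cV[R]_k) (x : 'cV[R]_k) :
  (forall i j, X t i j @[t --> F] --> x i j) ->
  gauss_pdf mu S (X t) @[t --> F] --> gauss_pdf mu S x.
Proof.
move=> Xx; have Xmu i j : (X t - mu) i j @[t --> F] --> (x - mu) i j.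
  under eq_fun do rewrite !mxE; rewrite !mxE.
  by apply: cvgB => //; exact: cvg_cst.
apply: cvgM; last exact: cvg_cst.
apply: (continuous_cvg _ (@continuous_expR R _)).
apply: cvgM; last exact: cvg_cst.
apply: cvgN; apply: cvg_mulmxE => // i j.
apply: cvg_mulmxE => [i' j'|i' j']; last exact: cvg_cst.
by under eq_fun do rewrite mxE; rewrite mxE; exact: Xmu.
Qed.

Lemma measurable_mulmxE d (T : measurableType d) a b c (A : 'M[R]_(a, b))
    (X : T -> 'M[R]_(b, c)) :
  (forall i j, measurable_fun setT (fun t => X t i j)) ->
  forall i j, measurable_fun setT (fun t => (A *m X t) i j).
Proof.
move=> mX i j; under eq_fun do rewrite mxE.
by apply: measurable_sum => k; exact: measurable_funM.
Qed.

Lemma gaussian_box_ratio d (Omega : measurableType d) (Pr : probability Omega R)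
    k (X : Omega -> 'cV[R]_k) mu S (x : 'cV[R]_k) :
  gaussian Pr X mu S ->
  fine (Pr (X @^-1` box (fun ij (x : 'cV[R]_k) => x ij.1 ij.2)
                        (fun ij => x ij.1 ij.2) e)) / (e *+ 2) ^+ k
    @[e --> 0^'+] --> gauss_pdf mu S x.
Proof.
move=> gX; apply: (has_density_box_ratio gX).
- by move=> ij; exact: measurable_mx_coord.
- by move=> e e0; rewrite exprn_gt0// mulrn_wgt0.
- move=> e e0.
  (* A vector is a matrix with one column, and with the zero prediction the residual box is a plain
     cube. *)
  rewrite -(expr1 (_ ^+ k)).
  rewrite -(@lebesgue_mx_triangular k 1 (fun=> 0) (fun ij => x ij.1 ij.2) e (ltW e0))//.
  congr (lebesgue_mx _ _ _ _); congr box.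
  by apply/funext => ij; apply/funext => z; rewrite subr0.
- apply: cvg_gauss_pdf => i j.
  exact: (@cvg_box_filter _ _ (fun ij (z : 'cV[R]_k) => z ij.1 ij.2)
    (fun ij => x ij.1 ij.2) (i, j)).
Qed.

(** The first column is predicted by 0, so that the residual [Z - state_pred A b Z] carries the
    initial state in its first column and the noises w_l in the others. *)
Definition state_pred n L (A : 'I_L -> 'M[R]_n) (b : 'I_L -> 'cV[R]_n)
    (Z : 'M[R]_(n, L.+1)) : 'M[R]_(n, L.+1) :=
  \matrix_(i, j) if unlift ord0 j is Some l
                 then (A l *m col (cur l) Z + b l) i 0 else 0.

Lemma col0_sub_state_pred n L A b (Z : 'M[R]_(n, L.+1)) :
  col ord0 (Z - state_pred A b Z) = col ord0 Z.
Proof. by apply/matrixP => i j; rewrite !mxE unlift_none subr0. Qed.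

Lemma colS_sub_state_pred n L A b (Z : 'M[R]_(n, L.+1)) l :
  col (nxt l) (Z - state_pred A b Z) =
  col (nxt l) Z - (A l *m col (cur l) Z + b l).
Proof. by apply/matrixP => i j; rewrite ord1 !mxE liftK !mxE. Qed.

Lemma state_pred_causal n L (A : 'I_L -> 'M[R]_n) b Z Z' (l : 'I_L.+1) :
  (forall j : 'I_L.+1, (j < l)%N -> col j Z = col j Z') ->
  col l (state_pred A b Z) = col l (state_pred A b Z').
Proof.
move=> ZZ'; apply/matrixP => i j; rewrite !mxE.
by case: unliftP ZZ' => // l' -> ->.
Qed.

Lemma measurable_state_pred n L (A : 'I_L -> 'M[R]_n) b i j :
  measurable_fun setT (fun Z => state_pred A b Z i j).
Proof.
under eq_fun do rewrite mxE.
case: unliftP => [l _|_]; last exact: measurable_cst.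
under eq_fun do rewrite mxE.
apply: measurable_funD => //; apply: measurable_mulmxE => k j'.
by under eq_fun do rewrite mxE; exact: measurable_mx_coord.
Qed.

(* The states are recovered recursively from the residuals. *)
Lemma cvg_state_residual n L (A : 'I_L -> 'M[R]_n) b (T : Type)
    (F : set_system T) {FF : Filter F} (Z : T -> 'M[R]_(n, L.+1))
    (Z0 : 'M[R]_(n, L.+1)) :
  (forall i j, (Z t - state_pred A b (Z t)) i j @[t --> F]
               --> (Z0 - state_pred A b Z0) i j) ->
  forall i j, Z t i j @[t --> F] --> Z0 i j.
Proof.
(* Induction on a bound for the column index, so that the previous column is available at each
   step. *)
move=> rZ i j; elim: {j}(j : nat) {-2}j (leqnn j) i => [|k IH] j jk i.
  have -> : j = ord0 by apply: val_inj; apply/eqP; rewrite -leqn0.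
  have := rZ i ord0; under eq_fun do rewrite !mxE unlift_none subr0.
  by rewrite !mxE unlift_none subr0.
case: (unliftP ord0 j) jk => [l ->|-> _]; last exact: IH.
rewrite lift0 ltnS => lk.
have ZE (W : 'M[R]_(n, L.+1)) : W i (lift ord0 l) =
    (W - state_pred A b W) i (lift ord0 l) + (A l *m col (cur l) W + b l) i 0.
  by rewrite !mxE liftK !mxE subrK.
under eq_fun do rewrite ZE; rewrite ZE.
apply: cvgD; first exact: rZ.
under eq_fun do rewrite mxE; rewrite mxE.
apply: cvgD; last exact: cvg_cst.
apply: cvg_mulmxE => [? ?|i' j']; first exact: cvg_cst.
by under eq_fun do rewrite mxE; rewrite mxE; exact: IH.
Qed.

(** The quotient of mass by volume of the residual boxes around (Z0, Y0) has two limits: the value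
    of [f], by continuity, and the product of Gaussian densities, by independence. Limits are
    unique. *)
Lemma hmm_density_unique n p q L dt (u : 'I_L -> 'cV[R]_(1 + q))
    (par : params R n p q) f Z0 Y0 :
  hmm_density dt u par f ->
  f (Z0, Y0) =
    gauss_pdf (par_mu0 par) (par_S0 par) (col ord0 Z0) *
    (\prod_(l < L) gauss_pdf 0 (par_Sw par)
       (col (nxt l) Z0 - (A_of dt (par_V par) (u l) *m col (cur l) Z0
                          + b_of dt (par_V par) (u l)))) *
    (\prod_(l < L.+1) gauss_pdf 0 (par_Sv par)
       (col l Y0 - (par_c0 par + Ct R n p *m col l Z0))).
Proof.
case=> cf [d] [X] [Pr] [Z] [Y] [w] [v] [H df].
have [Hinit Hw Hv Hind Hst Hobs] := H.
set A := fun l => A_of dt (par_V par) (u l).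
set b := fun l => b_of dt (par_V par) (u l).
pose predY (W : 'M[R]_(n, L.+1)) : 'M[R]_(p, L.+1) :=
  \matrix_(i, j) (par_c0 par + Ct R n p *m col j W) i 0.
pose rZ (W : 'M[R]_(n, L.+1)) := W - state_pred A b W.
pose rY (z : 'M[R]_(n, L.+1) * 'M[R]_(p, L.+1)) := z.2 - predY z.1.
have colY z l : col l (rY z) = col l z.2 - (par_c0 par + Ct R n p *m col l z.1).
  by apply/matrixP => i j; rewrite ord1 !mxE.
pose g (i : 'I_n * 'I_L.+1 + 'I_p * 'I_L.+1) (z : 'M[R]_(n, L.+1) * 'M[R]_(p, L.+1)) :=
  match i with inl ij => (rZ z.1) ij.1 ij.2 | inr ij => (rY z) ij.1 ij.2 end.
pose r i := g i (Z0, Y0).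
pose coord k (ij : 'I_k * 'I_1) (x : 'cV[R]_k) := x ij.1 ij.2.
pose at_ k (x : 'cV[R]_k) (ij : 'I_k * 'I_1) := x ij.1 ij.2.
(* One event per independent variable, centred at the corresponding residual of (Z0, Y0). *)
pose E (i : option 'I_L + 'I_L.+1) e : set X :=
  match i with
  | inl None => (fun o => col ord0 (Z o)) @^-1` box (@coord n) (at_ _ (col ord0 Z0)) e
  | inl (Some l) => w l @^-1` box (@coord n) (at_ _ (col (nxt l) (rZ Z0))) e
  | inr l => v l @^-1` box (@coord p) (at_ _ (col l (rY (Z0, Y0)))) e
  end.
pose dim (i : option 'I_L + 'I_L.+1) := if i is inl _ then n else p.
pose G (i : option 'I_L + 'I_L.+1) :=
  match i with
  | inl None => gauss_pdf (par_mu0 par) (par_S0 par) (col ord0 Z0)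
  | inl (Some l) => gauss_pdf 0 (par_Sw par) (col (nxt l) (rZ Z0))
  | inr l => gauss_pdf 0 (par_Sv par) (col l (rY (Z0, Y0)))
  end.
have EG i : fine (Pr (E i e)) / (e *+ 2) ^+ dim i @[e --> 0^'+] --> G i.
  case: i => [[l|]|l]; exact: gaussian_box_ratio.
have w0E o : col ord0 (rZ (Z o)) = col ord0 (Z o) by exact: col0_sub_state_pred.
have wE l o : col (nxt l) (rZ (Z o)) = w l o.
  by rewrite colS_sub_state_pred Hst addrAC subrr add0r.
have vE l o : col l (rY (Z o, Y o)) = v l o.
  by rewrite colY /= Hobs addrAC subrr add0r.
(* The residual box is exactly the joint occurrence of these events, so its mass is a product. *)
have XE e : (fun o => (Z o, Y o)) @^-1` box g r e =
    \bigcap_(i in [set` (finset.setT : {set option 'I_L + 'I_L.+1})]) E i e.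
  apply/seteqP; split=> o /=.
    move=> h [[l|]|l] _ [i j]; rewrite /coord /at_ /=.
    - by have := h (inl (i, nxt l)); rewrite -wE !col_entry.
    - rewrite -w0E -(col0_sub_state_pred A b Z0).
      by have := h (inl (i, ord0)); rewrite !col_entry.
    - by have := h (inr (i, l)); rewrite -vE !col_entry.
  move=> h [[i j]|[i j]].
    case: (unliftP ord0 j) => [l ->|->].
      by have := h (inl (Some l)) (finset.in_setT _) (i, ord0); rewrite /coord /at_ -wE !col_entry.
    have := h (inl None) (finset.in_setT _) (i, ord0).
    by rewrite /coord /at_ -w0E -(col0_sub_state_pred A b Z0) !col_entry.
  by have := h (inr j) (finset.in_setT _) (i, ord0); rewrite /coord /at_ -vE !col_entry.
have mbox k (x : 'cV[R]_k) e : measurable (box (@coord k) (at_ _ x) e).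
  by apply: measurable_box => ij; exact: measurable_mx_coord.
have mE i e : measurable (E i e).
  have mX k (V : X -> 'cV[R]_k) m S (x : 'cV[R]_k) : gaussian Pr V m S ->
      measurable (V @^-1` box (@coord k) (at_ _ x) e).
    by case=> mV _ _ _; rewrite -[X in measurable X]setTI; exact: mV (mbox _ _ _).
  by case: i => [[l|]|l]; [exact: (mX _ _ _ _ _ (Hw l))|exact: (mX _ _ _ _ _ Hinit)
    |exact: (mX _ _ _ _ _ (Hv l))].
have PrE e : fine (Pr ((fun o => (Z o, Y o)) @^-1` box g r e)) =
    \prod_i fine (Pr (E i e)).
  rewrite XE (Hind finset.setT (E^~ e)); last first.
    have sX k (V : X -> 'cV[R]_k) (x : 'cV[R]_k) :
        sigma_of V (V @^-1` box (@coord k) (at_ _ x) e).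
      by exists (box (@coord k) (at_ _ x) e); [exact: mbox|rewrite setTI].
    by move=> [[l|]|l] _; exact: sX.
  transitivity (fine (\prod_i (fine (Pr (E i e)))%:E)%E); last by rewrite prodEFin.
  congr fine; apply: eq_big => i; first by rewrite finset.in_setT.
  by move=> _; rewrite fineK// fin_num_measure.
have mrZ i j : measurable_fun setT (fun W => rZ W i j).
  under eq_fun do rewrite sub_entry.
  by apply: measurable_funB; [exact: measurable_mx_coord|exact: measurable_state_pred].
have lambda e : 0 < e -> prod_measure (lebesgue_mx R n L.+1) (lebesgue_mx R p L.+1)
    (box g r e) = (\prod_i (e *+ 2) ^+ dim i)%:E.
  move=> e0.
  pose BZ := box (fun ij W => (rZ W) ij.1 ij.2) (fun ij => r (inl ij)) e.
  pose BY W := box (fun ij V => (V - predY W) ij.1 ij.2) (fun ij => r (inr ij)) e.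
  rewrite (_ : box g r e = [set z | BZ z.1 /\ BY z.1 z.2]); last first.
    apply/seteqP; split=> [z h|z [h1 h2] [ij|ij]].
    - by split=> ij; [exact: (h (inl ij))|exact: (h (inr ij))].
    - exact: (h1 ij).
    - exact: (h2 ij).
  (* For given states, the observation box is a cube translated by the prediction [predY W]; its
     volume does not depend on W. *)
  rewrite (@prod_measure_sections _ _ _ _ _ _ _ _ (((e *+ 2) ^+ p) ^+ L.+1)).
  - rewrite lebesgue_mx_triangular ?ltW//; first last.
    + exact: measurable_state_pred.
    + exact: state_pred_causal.
    rewrite -EFinM; congr EFin; rewrite big_sumType /= mulrC.
    by rewrite !prodr_const card_option !card_ord.
  - by apply: measurable_box => ij; exact: mrZ.
  - move=> W _; rewrite /BY (lebesgue_mx_triangular (pred := fun=> predY W)) ?ltW//.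
have cvg1 : fine (Pr ((fun o => (Z o, Y o)) @^-1` box g r e)) / \prod_i (e *+ 2) ^+ dim i
    @[e --> 0^'+] --> f (Z0, Y0).
  apply: (has_density_box_ratio df).
  - move=> [ij|ij] /=; first exact: measurableT_comp (mrZ _ _) _.
    apply: (eq_measurable_fun (fun z : 'M[R]_(n, L.+1) * 'M[R]_(p, L.+1) =>
        z.2 ij.1 ij.2 - predY z.1 ij.1 ij.2)).
      by move=> z _; rewrite /= sub_entry.
    apply: measurable_funB.
      exact: measurableT_comp (measurable_mx_coord _ _) _.
    under eq_fun do rewrite !mxE.
    apply: measurable_funD => //; apply: measurable_sum => k.
    apply: measurable_funM => //; under eq_fun do rewrite mxE.
    exact: measurableT_comp (measurable_mx_coord _ _) _.
  - by move=> e e0; apply: prodr_gt0 => i _; rewrite exprn_gt0// mulrn_wgt0.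
  - exact: lambda.
  (* Convergence of the residuals gives convergence of the states, then of the observations, which
     are residual plus prediction from the states. Only then does continuity of [f] apply. *)
  - have cvgZ i j : (fun t : 'M[R]_(n, L.+1) * 'M[R]_(p, L.+1) => t.1 i j) @ box_filter g r
        --> Z0 i j.
      apply: (@cvg_state_residual _ _ A b _ _ _ (fun t : 'M[R]_(n, L.+1) * 'M[R]_(p, L.+1) => t.1)) => {}i {}j.
      exact: (@cvg_box_filter _ _ g r (inl (i, j))).
    have cvgY i j : (fun t : 'M[R]_(n, L.+1) * 'M[R]_(p, L.+1) => t.2 i j) @ box_filter g r
        --> Y0 i j.
      have YE (z : 'M[R]_(n, L.+1) * 'M[R]_(p, L.+1)) :
          z.2 i j = g (inr (i, j)) z + predY z.1 i j.
        by rewrite /= /rY sub_entry subrK.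
      rewrite -[Y0]/((Z0, Y0).2) YE; under eq_fun do rewrite YE.
      apply: cvgD; first exact: (@cvg_box_filter _ _ g r (inr (i, j))).
      under eq_fun do rewrite mxE mxE; rewrite mxE mxE.
      apply: cvgD; first exact: cvg_cst.
      apply: cvg_mulmxE => [? ?|i' j']; first exact: cvg_cst.
      by under eq_fun do rewrite mxE; rewrite mxE; exact: cvgZ.
    have cvgZY : (fun t : 'M[R]_(n, L.+1) * 'M[R]_(p, L.+1) => (t.1, t.2)) @ box_filter g r
        --> (Z0, Y0).
      exact: (@cvg_pair _ _ _ _ (nbhs Z0) (nbhs Y0) _ _ _ _ _ (cvg_mxE cvgZ) (cvg_mxE cvgY)).
    have := continuous_cvg _ (cf (Z0, Y0)) cvgZY.
    rewrite (_ : f \o _ = f); first by apply.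
    by apply/funext => -[].
have cvg2 : fine (Pr ((fun o => (Z o, Y o)) @^-1` box g r e)) / \prod_i (e *+ 2) ^+ dim i
    @[e --> 0^'+] --> \prod_i G i.
  under eq_fun do rewrite PrE -prodf_div.
  exact: cvg_bigprod.
rewrite (cvg_unique _ cvg1 cvg2) ?big_sumType /=; last exact: norm_hausdorff.
(* The index [None] contributes the initial density, and the indices [Some l] the transition
   densities. *)
rewrite (bigD1 None)//= (reindex_omap Some id)/=; last by case.
congr (_ * _ * _).
  by apply: eq_big => [l|l _]; rewrite ?eqxx// colS_sub_state_pred.
by apply: eq_bigr => l _; rewrite colY.
Qed.
End measure_boxes.

(** * Moments of random matrices *)

Section matrix_expectation.
Context (R : realType) d (Omega : measurableType d) (Pr : probability Omega R).

(** This class is stable under affine operations and its products are integrable, so every second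
    moment below exists and expands linearly. *)
Definition sq_integrable (f : Omega -> R) :=
  measurable_fun setT f /\ Pr.-integrable setT (fun o => (f o ^+ 2)%:E).

Lemma sq_integrable_cst c : sq_integrable (fun=> c).
Proof.
by split; [exact: measurable_cst|exact: finite_measure_integrable_cst].
Qed.

Lemma sq_integrableM f g : sq_integrable f -> sq_integrable g ->
  Pr.-integrable setT (EFin \o (fun o => f o * g o)).
Proof.
move=> [mf if2] [mg ig2].
apply: le_integrable (integrableD measurableT if2 ig2) => //.
  by apply/measurable_EFinP; exact: measurable_funM.
move=> o _ /=; rewrite lee_fin [leRHS]ger0_norm ?addr_ge0 ?sqr_ge0// ler_norml.
by nra.
Qed.

Lemma integrable_sq_integrable f : sq_integrable f ->
  Pr.-integrable setT (EFin \o f).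
Proof.
move=> /sq_integrableM/(_ (sq_integrable_cst 1)).
by congr (_.-integrable _ _); apply/funext => o /=; rewrite mulr1.
Qed.

Lemma sq_integrableD f g : sq_integrable f -> sq_integrable g ->
  sq_integrable (fun o => f o + g o).
Proof.
move=> [mf if2] [mg ig2]; split; first exact: measurable_funD.
have i2 : Pr.-integrable setT (fun o => ((2 * (f o ^+ 2 + g o ^+ 2))%:E)).
  under eq_fun do rewrite EFinM [X in (_ * X)%E]EFinD.
  by apply: integrableZl => //; exact: integrableD.
apply: le_integrable i2 => //.
  by apply/measurable_EFinP; apply: measurable_funX; exact: measurable_funD.
move=> o _ /=; rewrite lee_fin ger0_norm ?sqr_ge0// ger0_norm; last first.
  by rewrite mulr_ge0// addr_ge0// sqr_ge0.
by have := sqr_ge0 (f o - g o); lra.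
Qed.

Lemma sq_integrableZ c f : sq_integrable f -> sq_integrable (fun o => c * f o).
Proof.
move=> [mf if2]; split; first exact: measurable_funM.
under eq_fun do rewrite exprMn EFinM.
exact: integrableZl.
Qed.

Lemma sq_integrable_sum (I : Type) (s : seq I) (f : I -> Omega -> R) :
  (forall i, sq_integrable (f i)) -> sq_integrable (fun o => \sum_(i <- s) f i o).
Proof.
move=> hf; elim: s => [|i s IH].
  by under eq_fun do rewrite big_nil; exact: sq_integrable_cst.
by under eq_fun do rewrite big_cons; exact: sq_integrableD.
Qed.

Definition sq_integrable_mx a b (X : Omega -> 'M[R]_(a, b)) :=
  forall i j, sq_integrable (fun o => X o i j).

Definition integrable_mx a b (X : Omega -> 'M[R]_(a, b)) :=
  forall i j, Pr.-integrable setT (EFin \o (fun o => X o i j)).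

Definition emx a b (X : Omega -> 'M[R]_(a, b)) : 'M[R]_(a, b) :=
  \matrix_(i, j) \int[Pr]_o X o i j.

Lemma sq_integrable_mx_cst a b (A : 'M[R]_(a, b)) : sq_integrable_mx (fun=> A).
Proof. by move=> i j; exact: sq_integrable_cst. Qed.

Lemma sq_integrable_mxD a b (X Y : Omega -> 'M[R]_(a, b)) :
  sq_integrable_mx X -> sq_integrable_mx Y ->
  sq_integrable_mx (fun o => X o + Y o).
Proof.
move=> hX hY i j; under eq_fun do rewrite mxE.
exact: sq_integrableD.
Qed.

Lemma sq_integrable_mx_mull a b c (A : 'M[R]_(a, b)) (X : Omega -> 'M[R]_(b, c)) :
  sq_integrable_mx X -> sq_integrable_mx (fun o => A *m X o).
Proof.
move=> hX i j; under eq_fun do rewrite mxE.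
by apply: sq_integrable_sum => k; exact: sq_integrableZ.
Qed.

Lemma sq_integrable_mxB a b (X Y : Omega -> 'M[R]_(a, b)) :
  sq_integrable_mx X -> sq_integrable_mx Y ->
  sq_integrable_mx (fun o => X o - Y o).
Proof.
move=> hX hY; apply: sq_integrable_mxD => // i j.
by under eq_fun do rewrite mxE -mulN1r; exact: sq_integrableZ.
Qed.

Lemma sq_integrable_mxT a b (X : Omega -> 'M[R]_(a, b)) :
  sq_integrable_mx X -> sq_integrable_mx (fun o => (X o)^T).
Proof. by move=> hX i j; under eq_fun do rewrite mxE; exact: hX. Qed.

Lemma sq_integrable_mxW a b (X : Omega -> 'M[R]_(a, b)) :
  sq_integrable_mx X -> integrable_mx X.
Proof. by move=> hX i j; exact: integrable_sq_integrable. Qed.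

Lemma integrable_mx_cst a b (A : 'M[R]_(a, b)) : integrable_mx (fun=> A).
Proof. by apply: sq_integrable_mxW; exact: sq_integrable_mx_cst. Qed.

Lemma integrable_sumR (I : Type) (s : seq I) (f : I -> Omega -> R) :
  (forall i, Pr.-integrable setT (EFin \o f i)) ->
  Pr.-integrable setT (EFin \o (fun o => \sum_(i <- s) f i o)).
Proof.
move=> hf; rewrite /comp; under eq_fun do rewrite -sumEFin.
by apply: integrable_sum => // i _; exact: hf.
Qed.

Lemma Rintegral_sum (I : Type) (s : seq I) (f : I -> Omega -> R) :
  (forall i, Pr.-integrable setT (EFin \o f i)) ->
  \int[Pr]_o (\sum_(i <- s) f i o) = \sum_(i <- s) \int[Pr]_o f i o.
Proof.
move=> hf; elim: s => [|i s IH].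
  by under eq_Rintegral do rewrite big_nil; rewrite big_nil Rintegral_cst// mul0r.
under eq_Rintegral do rewrite big_cons.
by rewrite big_cons RintegralD// ?IH//; exact: integrable_sumR.
Qed.

Lemma integrable_mx_mul a b c (X : Omega -> 'M[R]_(a, b)) (Y : Omega -> 'M[R]_(b, c)) :
  sq_integrable_mx X -> sq_integrable_mx Y ->
  integrable_mx (fun o => X o *m Y o).
Proof.
move=> hX hY i j; under eq_fun do rewrite mxE.
by apply: integrable_sumR => k; exact: sq_integrableM.
Qed.

Lemma integrable_mxD a b (X Y : Omega -> 'M[R]_(a, b)) :
  integrable_mx X -> integrable_mx Y -> integrable_mx (fun o => X o + Y o).
Proof.
move=> hX hY i j; under eq_fun do rewrite mxE.
exact: (integrableD measurableT (hX i j) (hY i j)).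
Qed.

Lemma integrable_mxN a b (X : Omega -> 'M[R]_(a, b)) :
  integrable_mx X -> integrable_mx (fun o => - X o).
Proof.
move=> hX i j; under eq_fun do rewrite mxE.
exact: (integrableN (hX i j)).
Qed.

Lemma integrable_mx_mull a b c (A : 'M[R]_(a, b)) (X : Omega -> 'M[R]_(b, c)) :
  integrable_mx X -> integrable_mx (fun o => A *m X o).
Proof.
move=> hX i j; under eq_fun do rewrite mxE.
by apply: integrable_sumR => k; exact: (integrableZl measurableT _ (hX k j)).
Qed.

Lemma integrable_mxT a b (X : Omega -> 'M[R]_(a, b)) :
  integrable_mx X -> integrable_mx (fun o => (X o)^T).
Proof. by move=> hX i j; under eq_fun do rewrite mxE; exact: hX. Qed.

Lemma emx_cst a b (A : 'M[R]_(a, b)) : emx (fun=> A) = A.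
Proof.
by apply/matrixP => i j; rewrite mxE Rintegral_cst// [X in fine X]probability_setT mulr1.
Qed.

Lemma emxD a b (X Y : Omega -> 'M[R]_(a, b)) :
  integrable_mx X -> integrable_mx Y ->
  emx (fun o => X o + Y o) = emx X + emx Y.
Proof.
move=> hX hY; apply/matrixP => i j; rewrite !mxE -RintegralD//.
by apply: eq_Rintegral => o _; rewrite mxE.
Qed.

Lemma emx_mull a b c (A : 'M[R]_(a, b)) (X : Omega -> 'M[R]_(b, c)) :
  integrable_mx X -> emx (fun o => A *m X o) = A *m emx X.
Proof.
move=> hX; apply/matrixP => i j; rewrite !mxE.
under eq_Rintegral do rewrite mxE.
rewrite Rintegral_sum => [|k]; last exact: (integrableZl measurableT _ (hX k j)).
by apply: eq_bigr => k _; rewrite RintegralZl// mxE.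
Qed.

Lemma emxN a b (X : Omega -> 'M[R]_(a, b)) :
  integrable_mx X -> emx (fun o => - X o) = - emx X.
Proof.
move=> hX; rewrite -[RHS]mul1mx mulmxN -mulNmx -emx_mull//; congr emx.
by apply/funext => o; rewrite mulNmx mul1mx.
Qed.

Lemma emxB a b (X Y : Omega -> 'M[R]_(a, b)) :
  integrable_mx X -> integrable_mx Y ->
  emx (fun o => X o - Y o) = emx X - emx Y.
Proof.
by move=> hX hY; rewrite emxD ?emxN//; exact: integrable_mxN.
Qed.

Lemma emxT a b (X : Omega -> 'M[R]_(a, b)) : emx (fun o => (X o)^T) = (emx X)^T.
Proof.
apply/matrixP => i j; rewrite !mxE.
by apply: eq_Rintegral => o _; rewrite mxE.
Qed.

Lemma integrable_mx_mulr a b c (X : Omega -> 'M[R]_(a, b)) (A : 'M[R]_(b, c)) :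
  integrable_mx X -> integrable_mx (fun o => X o *m A).
Proof.
move=> /integrable_mxT/(@integrable_mx_mull _ _ _ A^T)/integrable_mxT.
by congr integrable_mx; apply/funext => o; rewrite trmx_mul !trmxK.
Qed.

Lemma emx_mulr a b c (X : Omega -> 'M[R]_(a, b)) (A : 'M[R]_(b, c)) :
  integrable_mx X -> emx (fun o => X o *m A) = emx X *m A.
Proof.
move=> hX; rewrite -[RHS]trmxK trmx_mul -emxT -emx_mull; last exact: integrable_mxT.
by rewrite -emxT; congr emx; apply/funext => o; rewrite -trmx_mul trmxK.
Qed.

Lemma integrable_mxtrace a (X : Omega -> 'M[R]_a) :
  integrable_mx X -> Pr.-integrable setT (EFin \o (fun o => \tr (X o))).
Proof. by move=> hX; exact: integrable_sumR. Qed.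

Lemma Rintegral_mxtrace a (X : Omega -> 'M[R]_a) :
  integrable_mx X -> \int[Pr]_o \tr (X o) = \tr (emx X).
Proof.
by move=> hX; rewrite Rintegral_sum//; apply: eq_bigr => i _; rewrite mxE.
Qed.

(** Here D, X' G and G play the roles of the second moment of the response, of its cross moment with
    the inputs, and of the second moment of the inputs. The normal equation H = X' G is what turns
    the linear terms into a square. *)
Lemma complete_square_mx k b (D : 'M[R]_k) (G : 'M[R]_b) (X X' : 'M[R]_(k, b)) :
  G^T = G ->
  D - X *m (X' *m G)^T - X' *m G *m X^T + X *m G *m X^T =
  D - X' *m (X' *m G)^T - X' *m G *m X'^T + X' *m G *m X'^T
  + (X - X') *m G *m (X - X')^T.
Proof.
move=> Gt.
have -> : (X - X') *m G *m (X - X')^T =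
    X *m G *m X^T - X' *m G *m X^T - (X *m G *m X'^T - X' *m G *m X'^T).
  by rewrite [(X - X')^T]linearB /= mulmxBr !mulmxBl.
rewrite trmx_mul Gt !mulmxA.
by apply/matrixP => i j; rewrite !(sub_entry, add_entry, opp_entry); ring.
Qed.

(* The second moment of the residual of a linear regression is a quadratic
   polynomial in the coefficients X; here its square is completed. *)
Lemma regression_residual k b (I : finType) (a : I -> Omega -> 'cV[R]_k)
    (phi : I -> Omega -> 'cV[R]_b) (c : R) (X X' : 'M[R]_(k, b)) :
  (forall i, sq_integrable_mx (a i)) -> (forall i, sq_integrable_mx (phi i)) ->
  let G := \sum_i emx (fun o => phi i o *m (phi i o)^T) + c%:M in
  let H := \sum_i emx (fun o => a i o *m (phi i o)^T) in
  let W (X : 'M[R]_(k, b)) :=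
    \sum_i emx (fun o => (a i o - X *m phi i o) *m (a i o - X *m phi i o)^T)
    + c *: (X *m X^T) in
  X' *m G = H ->
  W X = W X' + (X - X') *m G *m (X - X')^T.
Proof.
move=> ha hphi G H W X'G.
pose D := \sum_i emx (fun o => a i o *m (a i o)^T).
have Gt : G^T = G.
  rewrite linearD /= tr_scalar_mx linear_sum /=; congr (_ + _).
  apply: eq_bigr => i _; rewrite -emxT; congr emx.
  by apply/funext => o; rewrite trmx_mul trmxK.
(* The ridge term c Z Z^T is absorbed by the summand c I of G. *)
have WE Z : W Z = D - Z *m H^T - H *m Z^T + Z *m G *m Z^T.
  rewrite /W /G mulmxDr mulmxDl mul_mx_scalar -scalemxAl addrA; congr (_ + _).
  rewrite /D /H linear_sum /= !(mulmx_sumr, mulmx_suml) -!sumrB -big_split /=.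
  apply: eq_bigr => i _.
  have haa := integrable_mx_mul (ha i) (sq_integrable_mxT (ha i)).
  have hap := integrable_mx_mul (ha i) (sq_integrable_mxT (hphi i)).
  have hpa := integrable_mx_mul (hphi i) (sq_integrable_mxT (ha i)).
  have hpp := integrable_mx_mul (hphi i) (sq_integrable_mxT (hphi i)).
  have -> : (emx (fun o => a i o *m (phi i o)^T))^T =
      emx (fun o => phi i o *m (a i o)^T).
    by rewrite -emxT; congr emx; apply/funext => o; rewrite trmx_mul trmxK.
  rewrite -!emx_mull// -!emx_mulr//; last exact: integrable_mx_mull.
  have h1 := @integrable_mx_mull _ _ _ Z _ hpa.
  have h2 := @integrable_mx_mulr _ _ _ _ Z^T hap.
  have h3 := @integrable_mx_mulr _ _ _ _ Z^T (@integrable_mx_mull _ _ _ Z _ hpp).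
  have h4 := integrable_mxD haa (integrable_mxN h1).
  have h5 := integrable_mxD h4 (integrable_mxN h2).
  rewrite -emxB// -emxB// -emxD//; congr emx; apply/funext => o.
  by rewrite linearB /= trmx_mul mulmxBr !mulmxBl !mulmxA opprB addrA addrAC.
by rewrite (WE X) (WE X') -X'G; exact: complete_square_mx.
Qed.

(** Regression on the constant input 1 without ridge: G is the scalar #|I| and the optimal
    coefficient is the mean. The factor [1%:M] keeps the shape of the general quadratic term. *)
Lemma constant_regression_residual k (I : finType) (a : I -> Omega -> 'cV[R]_k)
    (x x' : 'cV[R]_k) :
  (forall i, sq_integrable_mx (a i)) -> #|I|%:R *: x' = \sum_i emx (a i) ->
  \sum_i emx (fun o => (a i o - x) *m (a i o - x)^T) =
  \sum_i emx (fun o => (a i o - x') *m (a i o - x')^T) +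
  #|I|%:R *: ((x - x') *m 1%:M *m (x - x')^T).
Proof.
move=> ha x'E; pose one (i : I) (o : Omega) : 'cV[R]_1 := 1%:M.
have := @regression_residual k 1 I a one 0 x x' ha (fun=> sq_integrable_mx_cst _).
have -> : \sum_i emx (fun o => one i o *m (one i o)^T) + 0%:M = #|I|%:R%:M.
  rewrite raddf0 addr0 /one; under eq_bigr do rewrite emx_cst trmx1 mulmx1.
  by rewrite sumr_const -scaler_nat scalemx1.
have -> : \sum_i emx (fun o => a i o *m (one i o)^T) = #|I|%:R *: x'.
  rewrite x'E; apply: eq_bigr => i _; congr emx.
  by apply/funext => o; rewrite trmx1 mulmx1.
rewrite /= mul_mx_scalar => /(_ erefl).
have oneE y : \sum_i emx (fun o => (a i o - y *m one i o) *m (a i o - y *m one i o)^T) =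
    \sum_i emx (fun o => (a i o - y) *m (a i o - y)^T).
  by apply: eq_bigr => i _; congr emx; apply/funext => o; rewrite mulmx1.
have drop0 (A B D E F : 'M[R]_k) : A + 0 *: E = B + 0 *: F + D -> A = B + D.
  by rewrite !scale0r !addr0.
move=> /drop0 RR.
apply: (etrans (etrans (esym (oneE x)) RR) (congr2 +%R (oneE x') _)).
by rewrite mul_mx_scalar mulmx1 scalemxAl.
Qed.

End matrix_expectation.

(** * Logarithm of a Gaussian density *)

Section gaussian_log.
Context (R : realType).

(** The quadratic form is written as a trace against a rank-one matrix, so that its expectation is a
    trace against a second moment. *)
Lemma ln_gauss_pdf k (mu : 'cV[R]_k) (S : 'M[R]_k) x : posdef S ->
  0 < gauss_pdf mu S x /\
  ln (gauss_pdf mu S x) =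
    - (\tr (invmx S *m ((x - mu) *m (x - mu)^T)) + ln (\det S)
       + k%:R * ln (2 * pi)) / 2.
Proof.
move=> pS; have dS := posdef_det_gt0 pS.
have pi2 : 0 < 2 * pi :> R by rewrite mulr_gt0// pi_gt0.
have D0 : 0 < (2 * pi) ^+ k * \det S by rewrite mulr_gt0// exprn_gt0.
have s0 : 0 < Num.sqrt ((2 * pi) ^+ k * \det S) by rewrite sqrtr_gt0.
split; first by rewrite divr_gt0// expR_gt0.
have lns : ln (Num.sqrt ((2 * pi) ^+ k * \det S)) =
    (ln (\det S) + k%:R * ln (2 * pi)) / 2.
  apply: (mulIf (x := 2)) => //; rewrite divfK// mulr_natr -lnXn//.
  by rewrite sqr_sqrtr ?ltW// lnM ?posrE ?exprn_gt0// lnXn// (mulr_natl (ln _)) addrC.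
rewrite ln_div ?posrE ?expR_gt0// expRK lns.
rewrite mulmxA mxtrace_mulC mulmxA trace_mx11.
by field.
Qed.

End gaussian_log.

(** * The state equation as a linear regression *)

Section state_regression.
Context (R : realType).

Lemma big_mxtens_index m n (F : 'I_(m * n) -> R) :
  \sum_a F a = \sum_k \sum_j F (mxtens_index (k, j)).
Proof.
rewrite (reindex (@mxtens_index m n)) /=; last first.
  exists (@mxtens_unindex m n) => a _; [exact: mxtens_indexK|exact: mxtens_unindexK].
by rewrite pair_bigA /=; apply: eq_bigr => -[].
Qed.

(* u \otimes (1, z) *)
Definition reg_input q n (u : 'cV[R]_(1 + q)) (z : 'cV[R]_n) :
    'cV[R]_((1 + q) * (1 + n)) :=
  \col_a (u (mxtens_unindex a).1 0 * (col_mx (1%:M : 'M[R]_1) z) (mxtens_unindex a).2 0).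

(* [V_0^T ... V_q^T] *)
Definition stack q n (V : {ffun 'I_(1 + q) -> 'M[R]_(1 + n, n)}) :
    'M[R]_(n, (1 + q) * (1 + n)) :=
  \matrix_(i, a) V (mxtens_unindex a).1 (mxtens_unindex a).2 i.

Lemma stack_inj q n : injective (@stack q n).
Proof.
move=> V V' VV'; apply/ffunP => k; apply/matrixP => j i.
have /matrixP/(_ i (mxtens_index (k, j))) := VV'.
by rewrite !mxE mxtens_indexK.
Qed.

Lemma stack_sqr q n (V : {ffun 'I_(1 + q) -> 'M[R]_(1 + n, n)}) :
  stack V *m (stack V)^T = \sum_k (V k)^T *m V k.
Proof.
apply/matrixP => i j; rewrite mxE big_mxtens_index summxE.
apply: eq_bigr => k _; rewrite mxE; apply: eq_bigr => l _.
by rewrite !mxE mxtens_indexK.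
Qed.

Lemma stack_mul q n (V : {ffun 'I_(1 + q) -> 'M[R]_(1 + n, n)}) u z :
  stack V *m reg_input u z = \sum_k u k 0 *: ((V k)^T *m col_mx 1%:M z).
Proof.
apply/matrixP => i j; rewrite ord1 mxE big_mxtens_index summxE.
apply: eq_bigr => k _; rewrite [RHS]mxE [in RHS]mxE mulr_sumr; apply: eq_bigr => l _.
by rewrite [in LHS]mxE [X in _ * X]mxE mxtens_indexK [in RHS]mxE mulrCA.
Qed.

(** The prediction is affine in V. Therefore the state residual is dt times the residual of the
    regression of (z' - z) / dt on [reg_input u z]. *)
Lemma A_b_of_stack q n dt (V : {ffun 'I_(1 + q) -> 'M[R]_(1 + n, n)}) u z :
  A_of dt V u *m z + b_of dt V u = z + dt *: (stack V *m reg_input u z).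
Proof.
(* The last n columns of the step matrix, transposed, are [b A]. *)
have -> : A_of dt V u *m z + b_of dt V u =
    (rsubmx (step_mx dt V u))^T *m col_mx 1%:M z.
  rewrite -[rsubmx _]vsubmxK tr_col_mx mul_row_col mulmx1 addrC.
  congr (_ + _); first by apply/matrixP => i j; rewrite !mxE.
  by congr (_ *m _); apply/matrixP => i j; rewrite !mxE.
rewrite /step_mx linearD /= linearZ /= linear_sum /= linearD /= linearZ /=.
rewrite mulmxDl -scalemxAl stack_mul; congr (_ + _ *: _).
  rewrite scalar_mx_block block_mxEh row_mxKr tr_col_mx trmx0 trmx1.
  by rewrite mul_row_col mul0mx mul1mx add0r.
rewrite linear_sum /= mulmx_suml; apply: eq_bigr => k _.
by rewrite !linearZ /= row_mxKr scalemxAl.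
Qed.

End state_regression.

(** * Moments in terms of means and covariances *)

Section moment_formulas.
Context (R : realType) d (Omega : measurableType d) (Pr : probability Omega R).

Local Notation emx := (emx Pr).
Local Notation integrable_mx := (integrable_mx Pr).
Local Notation sq_integrable_mx := (sq_integrable_mx Pr).

Ltac integrable_mx :=
  repeat first [assumption | exact: integrable_mx_cst | apply: integrable_mxD | apply: integrable_mxN |
    apply: integrable_mx_mull | apply: integrable_mx_mulr |
    apply: integrable_mxT].

Lemma mulmx_sub3_tr k (x y b : 'cV[R]_k) :
  (x - y - b) *m (x - y - b)^T =
  x *m x^T - y *m x^T - x *m y^T + y *m y^T - x *m b^T - b *m x^T
  + y *m b^T + b *m y^T + b *m b^T.
Proof. by apply/matrixP => i j; rewrite !(mxE, big_ord1); ring. Qed.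

(** The covariances are abstract matrices, so that the formula also covers a constant z' (an
    observation, with zero covariances) and A = 0 (the initial state). *)
Lemma emx_residual n k (z : Omega -> 'cV[R]_n) (z' : Omega -> 'cV[R]_k)
    (A : 'M[R]_(k, n)) (b : 'cV[R]_k) m m' S00 S01 S10 S11 :
  sq_integrable_mx z -> sq_integrable_mx z' ->
  emx z = m -> emx z' = m' ->
  emx (fun o => z o *m (z o)^T) = S00 + m *m m^T ->
  emx (fun o => z o *m (z' o)^T) = S01 + m *m m'^T ->
  emx (fun o => z' o *m (z o)^T) = S10 + m' *m m^T ->
  emx (fun o => z' o *m (z' o)^T) = S11 + m' *m m'^T ->
  emx (fun o => (z' o - A *m z o - b) *m (z' o - A *m z o - b)^T) =
  S11 - A *m S01 - S10 *m A^T + A *m S00 *m A^T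
  + (m' - A *m m - b) *m (m' - A *m m - b)^T.
Proof.
move=> hz hz' Ez Ez' E00 E01 E10 E11.
have i00 := integrable_mx_mul hz (sq_integrable_mxT hz).
have i01 := integrable_mx_mul hz (sq_integrable_mxT hz').
have i10 := integrable_mx_mul hz' (sq_integrable_mxT hz).
have i11 := integrable_mx_mul hz' (sq_integrable_mxT hz').
have i0 := sq_integrable_mxW hz; have i1 := sq_integrable_mxW hz'.
transitivity (emx (fun o => z' o *m (z' o)^T - A *m (z o *m (z' o)^T)
    - (z' o *m (z o)^T) *m A^T + A *m (z o *m (z o)^T) *m A^T
    - z' o *m b^T - b *m (z' o)^T + A *m z o *m b^T + b *m (z o)^T *m A^T
    + b *m b^T)).
  by congr emx; apply/funext => o; rewrite mulmx_sub3_tr trmx_mul !mulmxA.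
rewrite !(emxD, emxN); try by integrable_mx.
rewrite !(emx_mulr, emx_mull) ?emxT; try by integrable_mx.
rewrite emx_cst E00 E01 E10 E11 Ez Ez'.
rewrite mulmx_sub3_tr trmx_mul !(mulmxDl, mulmxDr) !mulmxA.
by apply/matrixP => i j; rewrite !(sub_entry, add_entry, opp_entry); ring.
Qed.

Lemma mean_colE n K (Z : Omega -> 'M[R]_(n, K)) k :
  mean_col Pr Z k = emx (fun o => col k (Z o)).
Proof.
apply/matrixP => i j; rewrite !mxE unlock /Rintegral; congr fine.
by apply: eq_integral => o _; rewrite col_entry.
Qed.

Lemma sq_integrable_mx_col n K (Z : Omega -> 'M[R]_(n, K)) k :
  sq_integrable_mx Z -> sq_integrable_mx (fun o => col k (Z o)).
Proof. by move=> hZ i j; under eq_fun do rewrite col_entry; exact: hZ. Qed.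

Lemma second_moment n K (Z : Omega -> 'M[R]_(n, K)) k l :
  sq_integrable_mx Z ->
  emx (fun o => col k (Z o) *m (col l (Z o))^T) =
  cov_col Pr Z k l + mean_col Pr Z k *m (mean_col Pr Z l)^T.
Proof.
move=> hZ; set a := mean_col Pr Z k; set b := mean_col Pr Z l.
have hk := sq_integrable_mx_col k hZ; have hl := sq_integrable_mx_col l hZ.
have -> : cov_col Pr Z k l =
    emx (fun o => (col k (Z o) - a) *m (col l (Z o) - b)^T).
  apply/matrixP => i j; rewrite !mxE unlock [in LHS]unlock /Rintegral; congr fine.
  by apply: eq_integral => o _; rewrite mxE big_ord1 !mxE unlock.
have i2 := integrable_mx_mul hk (sq_integrable_mxT hl).
have ik := sq_integrable_mxW hk; have il := sq_integrable_mxW hl.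
transitivity (emx (fun o => col k (Z o) *m (col l (Z o))^T - col k (Z o) *m b^T
    - a *m (col l (Z o))^T + a *m b^T) + a *m b^T); last first.
  congr (emx _ + _); apply/funext => o.
  rewrite linearB /= mulmxBl !mulmxBr.
  by apply/matrixP => i j; rewrite !(sub_entry, add_entry, opp_entry); ring.
rewrite !(emxD, emxN); try by integrable_mx.
rewrite !(emx_mulr, emx_mull) ?emxT; try by integrable_mx.
rewrite emx_cst -!mean_colE -/a -/b.
by apply/matrixP => i j; rewrite !(sub_entry, add_entry, opp_entry); ring.
Qed.

Lemma emx_block a1 a2 b1 b2 (A : Omega -> 'M[R]_(a1, b1)) (B : Omega -> 'M[R]_(a1, b2))
    (C : Omega -> 'M[R]_(a2, b1)) (D : Omega -> 'M[R]_(a2, b2)) :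
  emx (fun o => block_mx (A o) (B o) (C o) (D o)) =
  block_mx (emx A) (emx B) (emx C) (emx D).
Proof.
apply/matrixP => i j; rewrite mxE.
by case: (split_ordP i) => i' ->; case: (split_ordP j) => j' ->;
  rewrite ?(block_mxEul, block_mxEur, block_mxEdl, block_mxEdr) mxE;
  apply: eq_Rintegral => o _;
  rewrite ?(block_mxEul, block_mxEur, block_mxEdl, block_mxEdr).
Qed.

Lemma emx_row a b1 b2 (A : Omega -> 'M[R]_(a, b1)) (B : Omega -> 'M[R]_(a, b2)) :
  emx (fun o => row_mx (A o) (B o)) = row_mx (emx A) (emx B).
Proof.
apply/matrixP => i j; rewrite mxE.
by case: (split_ordP j) => j' ->; rewrite ?(row_mxEl, row_mxEr) mxE;
  apply: eq_Rintegral => o _; rewrite ?(row_mxEl, row_mxEr).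
Qed.

Lemma sq_integrable_mx_col1 n (z : Omega -> 'cV[R]_n) :
  sq_integrable_mx z -> sq_integrable_mx (fun o => col_mx (1%:M : 'M[R]_1) (z o)).
Proof.
move=> hz i j; case: (split_ordP i) => i' ->.
  under eq_fun do rewrite col_mxEu; exact: sq_integrable_cst.
under eq_fun do rewrite col_mxEd; exact: hz.
Qed.

Lemma sq_integrable_reg_input q n (u : 'cV[R]_(1 + q)) (z : Omega -> 'cV[R]_n) :
  sq_integrable_mx z -> sq_integrable_mx (fun o => reg_input u (z o)).
Proof.
move=> hz i j; under eq_fun do rewrite mxE; apply: sq_integrableZ.
exact: sq_integrable_mx_col1.
Qed.

Lemma tensmx_colT q (u : 'cV[R]_(1 + q)) :
  castmx (muln1 _, mul1n _) (tensmx u u^T) = u *m u^T.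
Proof.
apply/matrixP => k k'; rewrite castmxE /=.
have -> : cast_ord (esym (muln1 _)) k = mxtens_index (k, ord0).
  by apply: val_inj; rewrite /= muln1 addn0.
have -> : cast_ord (esym (mul1n _)) k' = mxtens_index (ord0, k').
  by apply: val_inj.
by rewrite tensmxE [RHS]mxE big_ord1.
Qed.

(** The mixed-product rule with zeta = (1, z): the matrix u u^T \otimes zeta zeta^T is the square of
    u \otimes zeta, and u is deterministic. This identifies a summand of G. *)
Lemma tensmx_second_moment q n (u : 'cV[R]_(1 + q)) (z : Omega -> 'cV[R]_n) m S :
  sq_integrable_mx z -> emx z = m ->
  emx (fun o => z o *m (z o)^T) = S + m *m m^T ->
  tensmx (castmx (muln1 _, mul1n _) (tensmx u u^T))
    (block_mx 1%:M m^T m (S + m *m m^T)) =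
  emx (fun o => reg_input u (z o) *m (reg_input u (z o))^T).
Proof.
move=> hz Ez Ezz.
pose zeta o := col_mx (1%:M : 'M[R]_1) (z o).
have hzeta : sq_integrable_mx zeta by exact: sq_integrable_mx_col1.
have -> : block_mx 1%:M m^T m (S + m *m m^T) = emx (fun o => zeta o *m (zeta o)^T).
  transitivity (emx (fun o => block_mx 1%:M (z o)^T (z o) (z o *m (z o)^T))).
    by rewrite emx_block emx_cst emxT Ez Ezz.
  congr emx; apply/funext => o.
  by rewrite tr_col_mx mul_col_row trmx1 mulmx1 mul1mx mulmx1.
rewrite tensmx_colT; apply/matrixP => a a'.
case: (mxtens_indexP a) => k j; case: (mxtens_indexP a') => k' j'.
rewrite tensmxE !mxE big_ord1 -RintegralZl//; last first.
  exact: (integrable_mx_mul hzeta (sq_integrable_mxT hzeta) j j').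
apply: eq_Rintegral => o _; rewrite !mxE !big_ord1 !mxE !mxtens_indexK /=.
by rewrite mulrACA.
Qed.

(** The same rule for a summand of H: u^T \otimes (a zeta^T) = a (u \otimes zeta)^T. *)
Lemma tensmx_cross_moment q n k (u : 'cV[R]_(1 + q)) (z : Omega -> 'cV[R]_n)
    (a : Omega -> 'cV[R]_k) ma maz :
  sq_integrable_mx z -> sq_integrable_mx a -> emx a = ma ->
  emx (fun o => a o *m (z o)^T) = maz ->
  castmx (mul1n _, erefl) (tensmx u^T (row_mx ma maz)) =
  emx (fun o => a o *m (reg_input u (z o))^T).
Proof.
move=> hz ha Ea Eaz.
pose zeta o := col_mx (1%:M : 'M[R]_1) (z o).
have hzeta : sq_integrable_mx zeta by exact: sq_integrable_mx_col1.
have -> : row_mx ma maz = emx (fun o => a o *m (zeta o)^T).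
  transitivity (emx (fun o => row_mx (a o) (a o *m (z o)^T))).
    by rewrite emx_row Ea Eaz.
  by congr emx; apply/funext => o; rewrite tr_col_mx mul_mx_row trmx1 mulmx1.
apply/matrixP => i b; rewrite castmxE /= cast_ord_id.
have -> : cast_ord (esym (mul1n _)) i = mxtens_index (ord0, i) by apply: val_inj.
case: (mxtens_indexP b) => k' j.
rewrite tensmxE !mxE -RintegralZl//; last first.
  exact: (integrable_mx_mul ha (sq_integrable_mxT hzeta) i j).
apply: eq_Rintegral => o _; rewrite !mxE !big_ord1 !mxE !mxtens_indexK /=.
by rewrite mulrCA.
Qed.

End moment_formulas.

(** * The regularized evidence lower bound *)

Section maximization.
Context (R : realType).

(** The quadratic term is nonnegative for every S and vanishes only at X = X'; the rest is N times
    the log-determinant inequality. A value not above the minimum closes both gaps. *)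
Lemma regression_min k b (N c : R) (S S' : 'M[R]_k) (X X' : 'M[R]_(k, b))
    (G : 'M[R]_b) :
  0 < N -> 0 < c -> posdef S -> posdef S' -> posdef G ->
  let f (S : 'M[R]_k) (X : 'M[R]_(k, b)) := N * ln (\det S) +
    \tr (invmx S *m (N *: S' + c *: ((X - X') *m G *m (X - X')^T))) in
  f S' X' <= f S X /\ (f S X <= f S' X' -> S = S' /\ X = X').
Proof.
move=> N0 c0 pS pS' pG f.
have fE (T : 'M[R]_k) (Z : 'M[R]_(k, b)) :
    f T Z = N * (ln (\det T) + \tr (invmx T *m S')) +
    c * \tr (invmx T *m ((Z - X') *m G *m (Z - X')^T)).
  by rewrite /f mulmxDr -!scalemxAr linearD /= !linearZ /= mulrDr addrA.
have [t0 tX] := mxtrace_posdef (X - X') (posdef_inv pS) pG.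
have [l0 lS] := ln_det_mxtrace_min pS pS'.
have f0 : f S' X' = N * (ln (\det S') + k%:R).
  by rewrite fE subrr !mul0mx mulmx0 linear0 mulr0 addr0 mulVmx ?posdef_unit// mxtrace1.
have ct0 := mulr_ge0 (ltW c0) t0.
have Nl0 : N * (ln (\det S') + k%:R) <= N * (ln (\det S) + \tr (invmx S *m S')).
  by rewrite ler_pM2l.
rewrite f0 fE; split; first by rewrite -[leLHS]addr0 lerD.
move=> le; split.
  apply: lS; apply/eqP; rewrite eq_le l0 /= -(ler_pM2l N0).
  by apply: le_trans le; rewrite lerDl.
apply/eqP; rewrite -subr_eq0; apply/eqP/tX/eqP; rewrite eq_le t0 andbT.
by rewrite -(pmulr_rle0 _ c0); move: le Nl0; lra.
Qed.

End maximization.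

(** * The regularized bound in terms of scatter matrices *)

Section objective_formula.
Context (R : realType) (n p q M L : nat) (dt gG gw g0 gv : R).
Context (u : 'I_M -> 'I_L -> 'cV[R]_(1 + q)) (Y : 'I_M -> 'M[R]_(p, L.+1)).
Context d (Omega : measurableType d) (Pr : probability Omega R).
Context (Zh : 'I_M -> Omega -> 'M[R]_(n, L.+1)).
Context (hZ : forall m, sq_integrable_mx Pr (Zh m)).

Local Notation emx := (emx Pr).
Local Notation mu := (fun m => mean_col Pr (Zh m)).
Local Notation S := (fun m => cov_col Pr (Zh m)).
Local Notation C := (Ct R n p).

Let z m k o := col k (Zh m o).

Let hz m k : sq_integrable_mx Pr (z m k).
Proof. exact: sq_integrable_mx_col. Qed.

Let Ez m k : emx (z m k) = mean_col Pr (Zh m) k.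
Proof. by rewrite mean_colE. Qed.

Let Ezz m k l : emx (fun o => z m k o *m (z m l o)^T) =
  cov_col Pr (Zh m) k l + mean_col Pr (Zh m) k *m (mean_col Pr (Zh m) l)^T.
Proof. exact: second_moment. Qed.

(** The scatter matrices carry the regularizer: a penalty (gamma / 2) Tr (S^-1) is half the trace of
    S^-1 against gamma I. *)
Definition init_scatter mu0 : 'M[R]_n :=
  \sum_m emx (fun o => (z m ord0 o - mu0) *m (z m ord0 o - mu0)^T) + g0%:M.

Definition state_residual V m l o : 'cV[R]_n :=
  z m (nxt l) o - (A_of dt V (u m l) *m z m (cur l) o + b_of dt V (u m l)).

(** The weight gG dt^2 becomes the ridge gG once dt^2 is factored out of the residuals. The sum runs
    over pairs because the regression has a single index type. *)
Definition state_scatter (V : {ffun 'I_(1 + q) -> 'M[R]_(1 + n, n)}) : 'M[R]_n :=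
  \sum_(ml : 'I_M * 'I_L)
    emx (fun o => state_residual V ml.1 ml.2 o *m (state_residual V ml.1 ml.2 o)^T)
  + (gG * dt ^+ 2) *: (\sum_k (V k)^T *m V k) + gw%:M.

Definition obs_residual c0 m l o : 'cV[R]_p := col l (Y m) - (c0 + C *m z m l o).

Definition obs_scatter c0 : 'M[R]_p :=
  \sum_(ml : 'I_M * 'I_L.+1)
    emx (fun o => obs_residual c0 ml.1 ml.2 o *m (obs_residual c0 ml.1 ml.2 o)^T)
  + gv%:M.

Lemma init_scatterE mu0 : (0 < M)%N ->
  init_scatter mu0 = M%:R *: update_S0 g0 mu S +
    M%:R *: ((mu0 - update_mu0 mu) *m 1%:M *m (mu0 - update_mu0 mu)^T).
Proof.
move=> M0; have M_neq0 : M%:R != 0 :> R by rewrite pnatr_eq0 -lt0n.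
have key : init_scatter mu0 = init_scatter (update_mu0 mu) +
    M%:R *: ((mu0 - update_mu0 mu) *m 1%:M *m (mu0 - update_mu0 mu)^T).
  have := @constant_regression_residual R d Omega Pr n 'I_M (fun m => z m ord0)
    mu0 (update_mu0 mu) (fun m => hz m ord0).
  rewrite card_ord => RR; rewrite [LHS]/init_scatter RR; first by rewrite addrAC.
  rewrite scalerA divff// scale1r; apply: eq_bigr => m _; exact/esym/Ez.
rewrite key; congr (_ + _).
rewrite /update_S0; move: (update_mu0 mu) => mu'.
rewrite scalerDr scalerA divff// scale1r scale_scalar_mx mulrC divfK//.
congr (_ + _); apply: eq_bigr => m _.
(* With coefficient A = 0 only the offset [mu'] is subtracted. *)
have := @emx_residual R d Omega Pr n n (z m ord0) (z m ord0) 0 mu' _ _ _ _ _ _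
  (hz _ _) (hz _ _) (Ez _ _) (Ez _ _) (Ezz _ _ _) (Ezz _ _ _) (Ezz _ _ _) (Ezz _ _ _).
rewrite !mul0mx trmx0 mulmx0 !subr0 addr0 => <-; congr emx.
by apply/funext => o; rewrite mul0mx subr0.
Qed.

Lemma obs_scatterE c0 : (0 < M)%N ->
  obs_scatter c0 = (M%:R * L.+1%:R) *: update_Sv gv Y mu S +
    (M%:R * L.+1%:R) *: ((c0 - update_c0 Y mu) *m 1%:M *m (c0 - update_c0 Y mu)^T).
Proof.
move=> M0; have N_neq0 : M%:R * L.+1%:R != 0 :> R.
  by rewrite mulf_neq0// pnatr_eq0 -lt0n.
(* The offset c_0 is the constant coefficient in a regression of y - C z. *)
pose a (ml : 'I_M * 'I_L.+1) o := col ml.2 (Y ml.1) - C *m z ml.1 ml.2 o.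
have ha ml : sq_integrable_mx Pr (a ml).
  by apply: sq_integrable_mxB; [exact: sq_integrable_mx_cst|exact: sq_integrable_mx_mull].
have aE c : \sum_ml emx (fun o => (a ml o - c) *m (a ml o - c)^T) =
    \sum_ml emx (fun o => obs_residual c ml.1 ml.2 o *m (obs_residual c ml.1 ml.2 o)^T).
  apply: eq_bigr => ml _; congr emx.
  by apply/funext => o; rewrite /obs_residual opprD addrA addrAC.
have key : obs_scatter c0 = obs_scatter (update_c0 Y mu) +
    (M%:R * L.+1%:R) *: ((c0 - update_c0 Y mu) *m 1%:M *m (c0 - update_c0 Y mu)^T).
  have := @constant_regression_residual R d Omega Pr p _ a c0 (update_c0 Y mu) ha.
  rewrite card_prod !card_ord natrM => RR.
  rewrite [LHS]/obs_scatter -(aE c0) RR; first by rewrite aE addrAC.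
  rewrite scalerA divff// scale1r pair_bigA; apply: eq_bigr => ml _ /=.
  rewrite -Ez -emx_mull; last exact: sq_integrable_mxW.
  rewrite -[X in X - _](emx_cst Pr) -emxB//; first exact: integrable_mx_cst.
  by apply: integrable_mx_mull; exact: sq_integrable_mxW.
rewrite key; congr (_ + _).
rewrite /update_Sv; move: (update_c0 Y mu) => c'.
rewrite scalerDr scalerA divff// scale1r scale_scalar_mx mulrC divfK//.
congr (_ + _); rewrite pair_bigA; apply: eq_bigr => -[m l] _ /=.
have iz : integrable_mx Pr (z m l) by exact: sq_integrable_mxW.
set y := col l (Y m).
(* The observation is deterministic; its zero covariances are written out to fit the general moment
   formula. *)
have Ezy : emx (fun o => z m l o *m y^T) = 0 + mean_col Pr (Zh m) l *m y^T.
  by rewrite add0r emx_mulr// Ez.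
have Eyz : emx (fun o => y *m (z m l o)^T) = 0 + y *m (mean_col Pr (Zh m) l)^T.
  by rewrite add0r emx_mull ?emxT ?Ez//; exact: integrable_mxT.
have Eyy : emx (fun=> y *m y^T) = 0 + y *m y^T by rewrite add0r emx_cst.
have := emx_residual C c' (hz m l) (sq_integrable_mx_cst _ _) (Ez m l) (emx_cst _ _)
  (Ezz m l l) Ezy Eyz Eyy.
rewrite mulmx0 mul0mx !subr0 add0r => E2.
rewrite (_ : y - c' - _ = y - C *m mean_col Pr (Zh m) l - c'); last by rewrite addrAC.
rewrite -E2; congr emx.
by apply/funext => o; rewrite /obs_residual opprD addrA addrAC.
Qed.

Lemma state_scatterE V : (0 < M)%N -> (0 < L)%N -> 0 < dt ->
  posdef (update_G gG u mu S) ->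
  state_scatter V = (M%:R * L%:R) *: update_Sw dt gG gw u mu S +
    dt ^+ 2 *: ((stack V - stack (update_V dt gG u mu S)) *m update_G gG u mu S
                *m (stack V - stack (update_V dt gG u mu S))^T).
Proof.
move=> M0 L0 dt0 pG.
have N_neq0 : M%:R * L%:R != 0 :> R by rewrite mulf_neq0// pnatr_eq0 -lt0n.
have dt_neq0 : dt != 0 by rewrite gt_eqF.
pose a (ml : 'I_M * 'I_L) o := dt^-1 *: (z ml.1 (nxt ml.2) o - z ml.1 (cur ml.2) o).
pose phi (ml : 'I_M * 'I_L) o := reg_input (u ml.1 ml.2) (z ml.1 (cur ml.2) o).
have haE ml : a ml = fun o => (dt^-1)%:M *m (z ml.1 (nxt ml.2) o - z ml.1 (cur ml.2) o).
  by apply/funext => o; rewrite mul_scalar_mx.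
have ha ml : sq_integrable_mx Pr (a ml).
  by rewrite haE; apply: sq_integrable_mx_mull; exact: sq_integrable_mxB.
have hphi ml : sq_integrable_mx Pr (phi ml) by exact: sq_integrable_reg_input.
set V' := update_V dt gG u mu S.
have RR := @regression_residual R d Omega Pr _ _ _ a phi gG (stack V) (stack V') ha hphi.
move: RR; rewrite /=.
have GE : \sum_ml emx (fun o => phi ml o *m (phi ml o)^T) + gG%:M = update_G gG u mu S.
  rewrite /update_G pair_bigA; congr (_ + _); apply: eq_bigr => -[m l] _ /=.
  by rewrite -(tensmx_second_moment (u m l) (hz m (cur l)) (Ez _ _) (Ezz _ _ _)).
have HE : \sum_ml emx (fun o => a ml o *m (phi ml o)^T) = update_H dt u mu S.
  rewrite /update_H pair_bigA; apply: eq_bigr => -[m l] _ /=.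
  apply/esym/tensmx_cross_moment => //.
    rewrite haE emx_mull ?mul_scalar_mx ?emxB ?Ez//; try exact: sq_integrable_mxW.
    by apply: sq_integrable_mxW; exact: sq_integrable_mxB.
  have i2 k := integrable_mx_mul (hz m k) (sq_integrable_mxT (hz m (cur l))).
  transitivity (emx (fun o => (dt^-1)%:M *m (z m (nxt l) o *m (z m (cur l) o)^T
      - z m (cur l) o *m (z m (cur l) o)^T))).
    by congr emx; apply/funext => o; rewrite -mulmxBl mul_scalar_mx scalemxAl.
  rewrite emx_mull ?emxB ?Ezz//; last first.
    by apply: integrable_mxD => //; exact: integrable_mxN.
  rewrite mul_scalar_mx -scalemxAl -scalerDr mulmxBl opprD addrACA.
  by [].
rewrite GE HE.
(* Stacking undoes the cutting of H G^-1 into blocks, which gives the normal equation. *)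
have V'E : stack V' = update_H dt u mu S *m invmx (update_G gG u mu S).
  apply/matrixP => i b; case: (mxtens_indexP b) => k j.
  by rewrite mxE mxtens_indexK /= ffunE mxE mxE.
have XG : stack V' *m update_G gG u mu S = update_H dt u mu S.
  by rewrite V'E mulmxKV// posdef_unit.
move=> /(_ XG).
have E1 W : state_scatter W = dt ^+ 2 *:
    (\sum_ml emx (fun o => (a ml o - stack W *m phi ml o) *m (a ml o - stack W *m phi ml o)^T)
     + gG *: (stack W *m (stack W)^T)) + gw%:M.
  rewrite /state_scatter -stack_sqr scalerDr scalerA [gG * _]mulrC scaler_sumr.
  congr (_ + _ + _); apply: eq_bigr => ml _.
  have hr : sq_integrable_mx Pr (fun o => a ml o - stack W *m phi ml o).
    by apply: sq_integrable_mxB => //; exact: sq_integrable_mx_mull.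
  rewrite -mul_scalar_mx -emx_mull; last first.
    exact: integrable_mx_mul hr (sq_integrable_mxT hr).
  congr emx; apply/funext => o; rewrite mul_scalar_mx expr2 -scalerA scalemxAl scalemxAr.
  have -> : state_residual W ml.1 ml.2 o = dt *: (a ml o - stack W *m phi ml o).
    rewrite /state_residual A_b_of_stack scalerBr scalerA divff// scale1r.
    by rewrite opprD addrA.
  by rewrite linearZ.
(* Scaling the regression identity by dt^2 and adding gw I turns its two residual terms into
   scatters. *)
move=> /(congr1 (fun A => dt ^+ 2 *: A + gw%:M)); rewrite -E1 scalerDr addrAC -E1 => ->.
congr (_ + _).
rewrite /state_scatter /update_Sw -/V' !scalerDr !scalerA divff// scale1r.
rewrite (mulrC _ (_ / _)) divfK// scale_scalar_mx (mulrC _ (gw / _)) divfK//.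
congr (_ + _ + _); rewrite pair_bigA; apply: eq_bigr => -[m l] _ /=.
rewrite -(emx_residual _ _ (hz m (cur l)) (hz m (nxt l)) (Ez _ _) (Ez _ _)
  (Ezz _ _ _) (Ezz _ _ _) (Ezz _ _ _) (Ezz _ _ _)).
by congr emx; apply/funext => o; rewrite /state_residual opprD addrA.
Qed.

Lemma sq_integrable_state_residual V m l :
  sq_integrable_mx Pr (state_residual V m l).
Proof.
apply: sq_integrable_mxB => //; apply: sq_integrable_mxD.
  exact: sq_integrable_mx_mull.
exact: sq_integrable_mx_cst.
Qed.

Lemma sq_integrable_obs_residual c0 m l :
  sq_integrable_mx Pr (obs_residual c0 m l).
Proof.
apply: sq_integrable_mxB; first exact: sq_integrable_mx_cst.
by apply: sq_integrable_mxD; [exact: sq_integrable_mx_cst|exact: sq_integrable_mx_mull].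
Qed.

Let mahalanobis k (W : 'M[R]_k) (x : 'cV[R]_k) := \tr (W *m (x *m x^T)).

Let integrable_mahalanobis k (W : 'M[R]_k) X : sq_integrable_mx Pr X ->
  Pr.-integrable setT (EFin \o (fun o => mahalanobis W (X o))).
Proof.
move=> hX; apply: integrable_mxtrace; apply: integrable_mx_mull.
exact: integrable_mx_mul hX (sq_integrable_mxT hX).
Qed.

Let Rintegral_mahalanobis k (W : 'M[R]_k) X : sq_integrable_mx Pr X ->
  \int[Pr]_o mahalanobis W (X o) = \tr (W *m emx (fun o => X o *m (X o)^T)).
Proof.
move=> hX; have iX := integrable_mx_mul hX (sq_integrable_mxT hX).
by rewrite Rintegral_mxtrace ?emx_mull//; exact: integrable_mx_mull.
Qed.

Definition objective (par : params R n p q) : R :=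
  (M%:R * ln (\det (par_S0 par)) +
     \tr (invmx (par_S0 par) *m init_scatter (par_mu0 par))) +
  (M%:R * L%:R * ln (\det (par_Sw par)) +
     \tr (invmx (par_Sw par) *m state_scatter (par_V par))) +
  (M%:R * L.+1%:R * ln (\det (par_Sv par)) +
     \tr (invmx (par_Sv par) *m obs_scatter (par_c0 par))).

(** The bound is an extended real; this formula shows that it is finite at admissible parameters, so
    that maximizing it is a problem about the real function [objective]. *)
Lemma elbo_regularizedE
    (P : params R n p q -> 'I_M -> 'M[R]_(n, L.+1) * 'M[R]_(p, L.+1) -> R)
    (Q : 'I_M -> 'M[R]_(n, L.+1) -> R) par :
  (forall m, Pr.-integrable setT (fun o => (ln (Q m (Zh m o)))%:E)) ->
  admissible par -> (forall m, hmm_density dt (u m) par (P par m)) ->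
  (elbo P Q Y Pr Zh par - (regularizer dt gG gw g0 gv par)%:E)%E =
  (- (\sum_m \int[Pr]_o ln (Q m (Zh m o))) -
   (M%:R * (n%:R + L%:R * n%:R + L.+1%:R * p%:R) * ln (2 * pi) + objective par) / 2)%:E.
Proof.
move=> hQ [pw p0 pv] hP.
have fin_int (f : Omega -> R) : Pr.-integrable setT (EFin \o f) ->
    ('E_Pr[f])%E = (\int[Pr]_o f o)%:E.
  by move=> hf; rewrite unlock fineK// integrable_fin_num.
have hr m l := sq_integrable_state_residual (par_V par) m l.
have hs m l := sq_integrable_obs_residual (par_c0 par) m l.
have h0 m : sq_integrable_mx Pr (fun o => z m ord0 o - par_mu0 par).
  by apply: sq_integrable_mxB => //; exact: sq_integrable_mx_cst.
(* For each m, -2 ln P splits into this deterministic part and the random part [T m], a sum of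
   quadratic forms in the residuals. *)
pose kappa := ln (\det (par_S0 par)) + L%:R * ln (\det (par_Sw par)) +
  L.+1%:R * ln (\det (par_Sv par)) +
  (n%:R + L%:R * n%:R + L.+1%:R * p%:R) * ln (2 * pi).
pose T m o := mahalanobis (invmx (par_S0 par)) (z m ord0 o - par_mu0 par) +
  \sum_l mahalanobis (invmx (par_Sw par)) (state_residual (par_V par) m l o) +
  \sum_l mahalanobis (invmx (par_Sv par)) (obs_residual (par_c0 par) m l o).
have lnP m o : ln (P par m (Zh m o, Y m)) = - 2^-1 * (T m o + kappa).
  have [g0p g0E] := ln_gauss_pdf (par_mu0 par) (z m ord0 o) p0.
  have gw_ l := ln_gauss_pdf 0 (state_residual (par_V par) m l o) pw.
  have gv_ l := ln_gauss_pdf 0 (obs_residual (par_c0 par) m l o) pv.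
  have Pw : 0 < \prod_l gauss_pdf 0 (par_Sw par) (state_residual (par_V par) m l o).
    by apply: prodr_gt0 => l _; case: (gw_ l).
  have Pv : 0 < \prod_l gauss_pdf 0 (par_Sv par) (obs_residual (par_c0 par) m l o).
    by apply: prodr_gt0 => l _; case: (gv_ l).
  have PE : P par m (Zh m o, Y m) =
      gauss_pdf (par_mu0 par) (par_S0 par) (z m ord0 o) *
      (\prod_l gauss_pdf 0 (par_Sw par) (state_residual (par_V par) m l o)) *
      (\prod_l gauss_pdf 0 (par_Sv par) (obs_residual (par_c0 par) m l o)).
    exact: (hmm_density_unique _ _ (hP m)).
  have Pgw := mulr_gt0 g0p Pw.
  rewrite PE lnM ?posrE// lnM ?posrE//.
  rewrite ln_prod; last by move=> l; case: (gw_ l).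
  rewrite ln_prod; last by move=> l; case: (gv_ l).
  rewrite g0E; under eq_bigr do rewrite (gw_ _).2 subr0.
  under [X in _ + X]eq_bigr do rewrite (gv_ _).2 subr0.
  rewrite -!mulr_suml !sumrN !big_split /= !sumr_const !card_ord.
  rewrite -!(mulr_natl (ln _)) -!(mulr_natl (_ * ln _)) /T /kappa /mahalanobis.
  by field.
have iw m l := integrable_mahalanobis (invmx (par_Sw par)) (hr m l).
have iv m l := integrable_mahalanobis (invmx (par_Sv par)) (hs m l).
have i0 m := integrable_mahalanobis (invmx (par_S0 par)) (h0 m).
pose ET m :=
  \tr (invmx (par_S0 par) *m emx (fun o =>
     (z m ord0 o - par_mu0 par) *m (z m ord0 o - par_mu0 par)^T)) +
  \sum_l \tr (invmx (par_Sw par) *m emx (fun o =>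
     state_residual (par_V par) m l o *m (state_residual (par_V par) m l o)^T)) +
  \sum_l \tr (invmx (par_Sv par) *m emx (fun o =>
     obs_residual (par_c0 par) m l o *m (obs_residual (par_c0 par) m l o)^T)).
have iw' m := integrable_sumR (index_enum 'I_L) (iw m).
have iv' m := integrable_sumR (index_enum 'I_L.+1) (iv m).
have i0w m := integrableD measurableT (i0 m) (iw' m).
have iT m : Pr.-integrable setT (EFin \o T m).
  exact: (integrableD measurableT (i0w m) (iv' m)).
have ic : Pr.-integrable setT (EFin \o (fun=> kappa)).
  exact: finite_measure_integrable_cst.
have iTk m : Pr.-integrable setT (EFin \o (fun o => T m o + kappa)).
  exact: (integrableD measurableT (iT m) ic).
have ElnP m : ('E_Pr[fun o => ln (P par m (Zh m o, Y m))])%E =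
    (- 2^-1 * (ET m + kappa))%:E.
  under eq_fun do rewrite lnP.
  rewrite fin_int; last exact: (integrableZl measurableT (- 2^-1) (iTk m)).
  congr EFin; rewrite RintegralZl// RintegralD// Rintegral_cst//.
  rewrite [X in fine X]probability_setT mulr1; congr (_ * (_ + _)).
  rewrite /T RintegralD; [|by []|exact: i0w|exact: iv'].
  rewrite RintegralD; [|by []|exact: i0|exact: iw'].
  rewrite (Rintegral_sum _ (iw m)) (Rintegral_sum _ (iv m)) (Rintegral_mahalanobis _ (h0 m)).
  congr (_ + _ + _); apply: eq_bigr => l _; exact: Rintegral_mahalanobis.
have Em m : ('E_Pr[fun o => ln (P par m (Zh m o, Y m))] -
    'E_Pr[fun o => ln (Q m (Zh m o))])%E =
    (- 2^-1 * (ET m + kappa) - \int[Pr]_o ln (Q m (Zh m o)))%:E.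
  by rewrite ElnP (fin_int _ (hQ m)) -EFinD.
rewrite /elbo (eq_bigr _ (fun m _ => Em m)) sumEFin -EFinB; congr EFin.
rewrite sumrB -mulr_sumr big_split /= sumr_const card_ord -(mulr_natl kappa).
have tr0 : \tr (invmx (par_S0 par) *m init_scatter (par_mu0 par)) =
    \sum_m \tr (invmx (par_S0 par) *m emx (fun o =>
      (z m ord0 o - par_mu0 par) *m (z m ord0 o - par_mu0 par)^T)) +
    g0 * \tr (invmx (par_S0 par)).
  by rewrite mulmxDr linearD /= mulmx_sumr linear_sum /= mul_mx_scalar mxtraceZ.
have trv : \tr (invmx (par_Sv par) *m obs_scatter (par_c0 par)) =
    \sum_m \sum_l \tr (invmx (par_Sv par) *m emx (fun o =>
      obs_residual (par_c0 par) m l o *m (obs_residual (par_c0 par) m l o)^T)) +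
    gv * \tr (invmx (par_Sv par)).
  rewrite mulmxDr linearD /= mul_mx_scalar mxtraceZ mulmx_sumr linear_sum.
  by congr (_ + _); rewrite [RHS]pair_bigA.
have trw : \tr (invmx (par_Sw par) *m state_scatter (par_V par)) =
    \sum_m \sum_l \tr (invmx (par_Sw par) *m emx (fun o =>
      state_residual (par_V par) m l o *m (state_residual (par_V par) m l o)^T)) +
    gG * dt ^+ 2 * (\sum_k \tr (invmx (par_Sw par) *m (par_V par k)^T *m par_V par k)) +
    gw * \tr (invmx (par_Sw par)).
  rewrite mulmxDr linearD /= mulmxDr linearD /= mul_mx_scalar mxtraceZ.
  rewrite mulmx_sumr linear_sum; congr (_ + _ + _); first by rewrite [RHS]pair_bigA.
  rewrite -scalemxAr mxtraceZ mulmx_sumr linear_sum /=; congr (_ * _).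
  by apply: eq_bigr => k _; rewrite mulmxA.
rewrite /objective /regularizer tr0 trw trv /ET !big_split /= /kappa.
by field.
Qed.

End objective_formula.

(** The three terms have no parameter in common, so they are minimized separately. *)
Lemma sum_regression_min (R : realType) n p q (N0 Nw Nv cw : R)
    (G : 'M[R]_((1 + q) * (1 + n))) (obj : params R n p q -> R) par :
  0 < N0 -> 0 < Nw -> 0 < Nv -> 0 < cw -> posdef G -> admissible par ->
  (forall par', obj par' =
    (N0 * ln (\det (par_S0 par')) + \tr (invmx (par_S0 par') *m (N0 *: par_S0 par +
       N0 *: ((par_mu0 par' - par_mu0 par) *m 1%:M *m (par_mu0 par' - par_mu0 par)^T)))) +
    (Nw * ln (\det (par_Sw par')) + \tr (invmx (par_Sw par') *m (Nw *: par_Sw par +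
       cw *: ((stack (par_V par') - stack (par_V par)) *m G
              *m (stack (par_V par') - stack (par_V par))^T)))) +
    (Nv * ln (\det (par_Sv par')) + \tr (invmx (par_Sv par') *m (Nv *: par_Sv par +
       Nv *: ((par_c0 par' - par_c0 par) *m 1%:M *m (par_c0 par' - par_c0 par)^T))))) ->
  forall par', admissible par' ->
    obj par <= obj par' /\ (obj par' <= obj par -> par = par').
Proof.
move=> N00 Nw0 Nv0 cw0 pG [pw p0 pv] objE par' [pw' p0' pv'].
have /= [le0 eq0] := regression_min (par_mu0 par') (par_mu0 par) N00 N00 p0' p0 (posdef1 R 1).
have /= [lev eqv] := regression_min (par_c0 par') (par_c0 par) Nv0 Nv0 pv' pv (posdef1 R 1).
have /= [lew eqw] := regression_min (stack (par_V par')) (stack (par_V par)) Nw0 cw0 pw' pw pG.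
rewrite !objE; split; first exact: lerD (lerD le0 lew) lev.
(* If the sum does not exceed its minimum, the lower bounds on two of the terms leave no excess for
   the third. *)
move=> le; have [|S0E mu0E] := eq0; first by move: le lev lew; lra.
have [|SvE c0E] := eqv; first by move: le le0 lew; lra.
have [|SwE /(@stack_inj _ _ _) VE] := eqw; first by move: le le0 lev; lra.
by case: par par' S0E mu0E SvE c0E SwE VE {pw p0 pv objE pw' p0' pv' le0 eq0 lev eqv lew eqw le} =>
  V c Sw Sv m0 S0 [V' c' Sw' Sv' m0' S0'] /= -> -> -> -> -> ->.
Qed.

Theorem theorem4p1 (R : realType) (n p q M L : nat)
    (p_ge1 : (1 <= p)%N) (n_gep : (p <= n)%N) (M_ge1 : (1 <= M)%N) (L_ge1 : (1 <= L)%N)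
    (u : 'I_M -> 'I_L -> 'cV[R]_(1 + q)) (u0 : forall m l, u m l 0 0 = 1)
    (Y : 'I_M -> 'M[R]_(p, L.+1))
    (dt : R) (dt_gt0 : 0 < dt)
    (gG gw g0 gv : R)
    (gG_ge0 : 0 <= gG) (gw_ge0 : 0 <= gw) (g0_ge0 : 0 <= g0) (gv_ge0 : 0 <= gv)
    (P : params R n p q -> 'I_M -> 'M[R]_(n, L.+1) * 'M[R]_(p, L.+1) -> R)
    (P_density : forall par, admissible par ->
       forall m, hmm_density dt (u m) par (P par m))
    (Q : 'I_M -> 'M[R]_(n, L.+1) -> R)
    (d : measure_display) (Omega : measurableType d) (Pr : probability Omega R)
    (Zh : 'I_M -> Omega -> 'M[R]_(n, L.+1))
    (Zh_density : forall m, has_density Pr (Zh m) (lebesgue_mx R n L.+1) (Q m))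
    (Zh_moments : forall m i k,
       Pr.-integrable setT (fun o => ((Zh m o i k) ^+ 2)%:E))
    (Zh_entropy : forall m,
       Pr.-integrable setT (fun o => (ln (Q m (Zh m o)))%:E)) :
  let mu := fun m => mean_col Pr (Zh m) in
  let S := fun m => cov_col Pr (Zh m) in
  let par := update dt gG gw g0 gv u Y mu S in
  posdef (update_G gG u mu S) ->
  posdef (par_Sw par) -> posdef (par_S0 par) -> posdef (par_Sv par) ->
  unique
    (is_maximizer (@admissible R n p q)
       (fun par' => elbo P Q Y Pr Zh par' - (regularizer dt gG gw g0 gv par')%:E)%E)
    par.
Proof.
(* The common constant cancels and the factor -1/2 reverses the order. *)
have valM (a k x y : R) : (a - (k + x) / 2 <= a - (k + y) / 2) = (y <= x).
  by rewrite lerD2l lerN2 ler_pM2r ?invr_gt0// lerD2l.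
move=> mu S par pG pw p0 pv.
have hZ m : sq_integrable_mx Pr (Zh m).
  move=> i j; split; last exact: Zh_moments.
  have [mZ _ _ _] := Zh_density m.
  exact: measurableT_comp (measurable_mx_coord i j) mZ.
have M0 : 0 < M%:R :> R by rewrite ltr0n.
have L0 : 0 < L%:R :> R by rewrite ltr0n.
have L10 : 0 < L.+1%:R :> R by rewrite ltr0n.
pose obj := objective dt gG gw g0 gv u Y Pr Zh.
have adm : admissible par by [].
have opt := @sum_regression_min _ _ _ _ _ _ _ _ _ obj par M0 (mulr_gt0 M0 L0)
  (mulr_gt0 M0 L10) (exprn_gt0 2 dt_gt0) pG adm.
have objE par' : obj par' =
    (M%:R * ln (\det (par_S0 par')) + \tr (invmx (par_S0 par') *m (M%:R *: par_S0 par +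
       M%:R *: ((par_mu0 par' - par_mu0 par) *m 1%:M *m (par_mu0 par' - par_mu0 par)^T)))) +
    (M%:R * L%:R * ln (\det (par_Sw par')) + \tr (invmx (par_Sw par') *m
       ((M%:R * L%:R) *: par_Sw par +
        dt ^+ 2 *: ((stack (par_V par') - stack (par_V par)) *m update_G gG u mu S
                    *m (stack (par_V par') - stack (par_V par))^T)))) +
    (M%:R * L.+1%:R * ln (\det (par_Sv par')) + \tr (invmx (par_Sv par') *m
       ((M%:R * L.+1%:R) *: par_Sv par +
        (M%:R * L.+1%:R) *: ((par_c0 par' - par_c0 par) *m 1%:M
                             *m (par_c0 par' - par_c0 par)^T)))).
  rewrite /obj /objective (init_scatterE g0 hZ (par_mu0 par') M_ge1).
  rewrite (obs_scatterE gv Y hZ (par_c0 par') M_ge1).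
  by rewrite (state_scatterE gw hZ (par_V par') M_ge1 L_ge1 dt_gt0 pG).
have {}opt := opt objE.
have valE par' : admissible par' ->
    (elbo P Q Y Pr Zh par' - (regularizer dt gG gw g0 gv par')%:E)%E =
    (- (\sum_m \int[Pr]_o ln (Q m (Zh m o))) -
     (M%:R * (n%:R + L%:R * n%:R + L.+1%:R * p%:R) * ln (2 * pi) + obj par') / 2)%:E.
  by move=> adm'; apply: elbo_regularizedE => // m; exact: P_density.
split.
  split=> // par' adm'; rewrite (valE _ adm) (valE _ adm') lee_fin valM.
  by have [] := opt _ adm'.
(* Another maximizer does at least as well as [par], hence its objective is not larger, and the
   equality case applies. *)
move=> par' [adm' /(_ _ adm)].
rewrite [X in (X <= _)%E](valE _ adm) [X in (_ <= X)%E](valE _ adm') lee_fin valM.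
exact: (opt _ adm').2.
Qed.
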